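(* Suppose that $n-m_0+\ell_0=1$. Let $K_0$ be a perfect subfield of $K$ such that $\mathrm{char}(K_0)$ does not divide $\ell_0$. Let $f(x)\in K_0[x]$ be a degree $n$ polynomial without repeated roots, and let $\mathcal P\in\mathcal C_{f,d}(K_0)$. Then the following conditions are equivalent. (i) $\mathcal P$ is a point of order $m_0$ on $\mathcal C_{f,d}$. (ii) There exist nonzero $B,B_1\in K_0$ that enjoy the following properties. (a) The polynomial $f_{B,B_1}(x)=-B^d x^{m_0}+(Bx^{\ell_0}+B_1x+1)^d$ has no repeated roots. (b) There is an isomorphism of $K_0$-curves $\Psi:\mathcal C_{f,d}\to\mathcal C_{f_{B,B_1},d}$ that sends $\mathcal O_{f,d}$ to $\mathcal O_{f_{B,B_1},d}$ and $\mathcal P$ to $(0,1)\in\mathcal C_{f_{B,B_1},d}(K_0)$. If these equivalent conditions hold (with $B,B_1,\Psi$ as in (ii)), then $(0,1)$ is a $K_0$-point of order $m_0$ on $\mathcal C_{f_{B,B_1},d}$ and $\mathcal Q_d=(-1/B_1,0)$ is a $K_0$-point of order $d$ on $\mathcal C_{f_{B,B_1},d}$. In addition, $\Psi^{-1}(\mathcal Q_d)$ is a $K_0$-point of order $d$ on $\mathcal C_{f,d}$.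
   Context: $K$ is an algebraically closed field; $n,d$ are integers with $2\le d<n$, $\gcd(n,d)=1$, $\mathrm{char}(K)\nmid d$. Put $\ell_0:=[(n+d)/d]$ (integer part) and $m_0:=d\ell_0$. For a degree $n$ polynomial $f(x)\in K[x]$ without repeated roots, $\mathcal C_{f,d}$ is the smooth projective model of the smooth plane affine curve $y^d=f(x)$, and $\mathcal O_{f,d}$ is its unique point at infinity. If $f(x)\in K_0[x]$ for a perfect subfield $K_0\subset K$, then $\mathcal C_{f,d}$ is viewed as a curve over $K_0$, and $\mathcal O_{f,d}$ is a $K_0$-point. The curve $\mathcal C_{f,d}$ is identified with its image in its Jacobian $J(\mathcal C_{f,d})$ under the embedding sending $\mathcal O_{f,d}$ to $0$; a point of $\mathcal C_{f,d}$ has order $m$ if its image in $J(\mathcal C_{f,d})$ has order $m$. *)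

(* Defs.v *)
From HB Require Import structures.
From mathcomp Require Import all_boot all_order all_algebra.
From mathcomp Require Import boolp classical_sets.
From mathcomp.multinomials Require Import freeg.

Set Implicit Arguments.
Unset Strict Implicit.
Unset Printing Implicit Defensive.

Import Order.TTheory GRing.Theory Num.Theory.
Local Open Scope ring_scope.

Definition no_repeated_roots (K : fieldType) (f : {poly K}) : Prop :=
  forall a : K, ~~ (('X - a%:P) ^+ 2 %| f).

(* A subfield K0 of K is perfect when its Frobenius is onto (a void
   condition in characteristic 0). *)
Definition perfect_subfield (K : fieldType) (K0 : divringClosed K) : Prop :=
  forall p : nat, p \in [pchar K] ->
  forall a, a \in K0 -> exists2 b, b \in K0 & b ^+ p = a.

Definition has_order (G : zmodType) (g : G) (m : nat) : Prop :=
  [/\ (0 < m)%N, g *+ m = 0 & forall k, (0 < k < m)%N -> g *+ k != 0].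

Section Curve.
Variables (K : closedFieldType) (f : {poly K}) (d : nat).

(* K-points of the smooth projective model of y^d = f(x), when the affine curve
   is smooth and has exactly one point at infinity: Some (a, b) is an affine
   point and None is the point at infinity. *)
Definition on_curve (P : option (K * K)) : bool :=
  if P is Some (a, b) then b ^+ d == f.[a] else true.

Record point := Point { point_val :> option (K * K); _ : on_curve point_val }.
HB.instance Definition _ := [isSub for point_val].
HB.instance Definition _ := [Choice of point by <:].

Definition infty : point := @Point None isT.

Definition rational_point (K0 : {pred K}) (P : point) : Prop :=
  if val P is Some (a, b) then a \in K0 /\ b \in K0 else True.

(* K(C) = K(x)[y] / (y^d - f(x)).  It is a field as soon as y^d - f(x) is
   irreducible over K(x), e.g. if deg f is prime to d. *)
Definition funfield : Type :=
  {poly %/ (map_poly (@tofrac {poly K}) ('X^d - f%:P))}.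
HB.instance Definition _ := GRing.ComUnitRing.on funfield.

(* u(x, y) for a polynomial u in y with coefficients in K[x] *)
Definition funxy (u : {poly {poly K}}) : funfield :=
  in_qpoly _ (map_poly (@tofrac {poly K}) u).

Definition funC (c : K) : funfield := funxy c%:P%:P.
Definition funX : funfield := funxy 'X%:P.
Definition funY : funfield := funxy 'X.

(* K_0(C) = K_0(x, y) inside K(C) *)
Definition rational_fun (K0 : divringClosed K) (h : funfield) : Prop :=
  exists u w : {poly {poly K}},
    [/\ u \is a polyOver (polyOver K0), w \is a polyOver (polyOver K0),
        funxy w \is a GRing.unit & h = funxy u / funxy w].

(* Normalized discrete valuations of K(C)/K, with the convention v 0 = 0 in
   place of +oo. *)
Definition is_valuation (v : funfield -> int) : Prop :=
  [/\ v 0 = 0,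
      forall g h, g != 0 -> h != 0 -> v (g * h) = v g + v h,
      forall g h, g != 0 -> h != 0 -> g + h != 0 ->
        Order.min (v g) (v h) <= v (g + h),
      forall c : K, v (funC c) = 0 &
      exists2 t, t != 0 & v t = 1].

Definition centered (P : point) (v : funfield -> int) : Prop :=
  if val P is Some (a, b) then 0 < v (funX - funC a) /\ 0 < v (funY - funC b)
  else v funX < 0.

(* Order of vanishing at P.  The points of the smooth projective model are the
   places of K(C)/K; when the affine curve is smooth and has one point at
   infinity, exactly one valuation is centered at each P. *)
Definition ord (P : point) : funfield -> int :=
  xget (fun=> 0) [set v | is_valuation v /\ centered P v]%classic.

Definition regular (P : point) (h : funfield) : Prop := h = 0 \/ 0 <= ord P h.

Definition deg0 : {pred {freeg point}} := fun D => deg D == 0.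

Fact deg0_zmod : zmod_closed deg0.
Proof.
split=> [|D E]; rewrite /deg0 !unfold_in ?raddf0 // raddfB /=.
by move=> /eqP-> /eqP->; rewrite subr0.
Qed.
HB.instance Definition _ := GRing.isZmodClosed.Build {freeg point} deg0 deg0_zmod.

Record divisor0 := Divisor0
  { div0_val :> {freeg point}; div0P : div0_val \in deg0 }.
HB.instance Definition _ := [isSub for div0_val].
HB.instance Definition _ := [Choice of divisor0 by <:].
HB.instance Definition _ := [SubChoice_isSubZmodule of divisor0 by <:].

Definition principal_prop (D : divisor0) : Prop :=
  exists2 g : funfield, g \is a GRing.unit &
    forall P : point, coeff P (val D) = ord P g.

Definition principal : {pred divisor0} := fun D => `[< principal_prop D >].

Lemma ordM P g h : g != 0 -> h != 0 -> ord P (g * h) = ord P g + ord P h.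
Proof.
rewrite /ord; case: xgetP => [v _ [[_ vM _ _ _] _]|_]; first exact: vM.
by rewrite addr0.
Qed.

Fact principal_zmod : zmod_closed principal.
Proof.
have ord1 P : ord P 1 = 0.
  have := @ordM P 1 1 (oner_neq0 _) (oner_neq0 _).
  by rewrite mulr1 -[LHS]addr0 => /addrI.
have unit_neq0 (g : funfield) : g \is a GRing.unit -> g != 0.
  by apply: contraTneq => ->; rewrite unitr0.
split=> [|D E].
  by apply/asboolP; exists 1; rewrite ?unitr1 // => P; rewrite ord1 raddf0.
move=> /asboolP[g Ug Dg] /asboolP[h Uh Eh]; apply/asboolP.
exists (g / h) => [|P]; first by rewrite unitrM Ug unitrV.
have Uh' : h^-1 \is a GRing.unit by rewrite unitrV.
rewrite !raddfB /= Dg Eh ordM ?unit_neq0 //; congr (_ + _).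
apply/eqP; rewrite eq_sym -addr_eq0; apply/eqP.
by rewrite -ordM ?unit_neq0 // mulVr.
Qed.
HB.instance Definition _ :=
  GRing.isZmodClosed.Build divisor0 principal principal_zmod.

(* J(C)(K) = Pic^0(C) *)
Definition jacobian : zmodType := Quotient.quot principal.

Fact deg_point_infty (P : point) : << P >> - << infty >> \in deg0.
Proof. by rewrite /deg0 unfold_in raddfB /= !degU subrr. Qed.

(* P |-> the class of (P) - (O) *)
Definition to_jacobian (P : point) : jacobian :=
  \pi_(Quotient.quot principal)%qT (Divisor0 (deg_point_infty P)).

Definition point_order (P : point) (m : nat) : Prop :=
  has_order (to_jacobian P) m.

End Curve.

Arguments infty {K f d}.

(* Isomorphisms of K_0-curves, as isomorphisms of ringed spaces: a bijection on
   K-points and a K-linear isomorphism pb : h |-> h o iso_map of the rational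
   functions which identifies the local rings at corresponding points, and
   which is defined over K_0. *)
Record curve_iso (K : closedFieldType) (K0 : divringClosed K)
    (f g : {poly K}) (d : nat) := CurveIso {
  iso_map :> point f d -> point g d;
  iso_inv : point g d -> point f d;
  iso_mapK : cancel iso_map iso_inv;
  iso_invK : cancel iso_inv iso_map;
  iso_pb : {rmorphism funfield g d -> funfield f d};
  iso_pb_bij : bijective iso_pb;
  iso_pbC : forall c : K, iso_pb (funC g d c) = funC f d c;
  iso_pb_regular : forall (P : point f d) (h : funfield g d),
    regular (iso_map P) h <-> regular P (iso_pb h);
  iso_pb_rational : forall h : funfield g d,
    rational_fun K0 h <-> rational_fun K0 (iso_pb h)
}.

Definition ell0 (n d : nat) : nat := (n + d) %/ d.
Definition m0 (n d : nat) : nat := d * ell0 n d.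

Definition fBB (K : fieldType) (n d : nat) (B B1 : K) : {poly K} :=
  - (B ^+ d *: 'X^(m0 n d)) + (B *: 'X^(ell0 n d) + B1 *: 'X + 1) ^+ d.

Definition normal_form (K : closedFieldType) (K0 : divringClosed K)
    (n d : nat) (f : {poly K}) (P : point f d)
    (B B1 : K) (Psi : curve_iso K0 f (fBB n d B B1) d) : Prop :=
  [/\ B \in K0 /\ B != 0, B1 \in K0 /\ B1 != 0,
      no_repeated_roots (fBB n d B B1),
      Psi infty = infty & val (Psi P) = Some (0, 1)].

(* Main.v *)
(* On C : y^d = f(x) the functions x and y have poles of order d and n at O and are
   regular elsewhere, and K[x, y] is the ring of functions regular off O. If P = (a, b)
   has order m0 = d l, with l = ell0 n d, then m0 (P) - m0 (O) is the divisor of some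
   y - c(x) with deg c = l, since m0 < 2n and l <= d. Its norm c^d - f has no root but a,
   so f = c^d - (B (x - a)^l)^d; comparing degrees, c - B (x - a)^l is linear, and the
   affine change of coordinates taking P to (0, 1) takes f to f_{B,B1}. The constants
   are in K_0 because they are read off two coefficients of this expression.
   Conversely, y - (B x^l + B1 x + 1) has divisor m0 (0, 1) - m0 (O). If the
   order k of (0, 1), a divisor of m0 < 2n, is less than m0, then k < n and
   k (0, 1) - k (O) is the divisor of a polynomial in x, which is absurd as the points (0, b) with b^d = 1 are distinct.
   The place of K(C) at an affine point is found by showing that its local ring has
   a principal maximal ideal, and the place at O by weighted degrees. *)

Require Import Defs.
From HB Require Import structures.
From mathcomp Require Import all_boot all_order all_algebra.
From mathcomp Require Import separable cyclotomic qfpoly.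
From mathcomp Require Import boolp classical_sets.
From mathcomp.multinomials Require Import freeg.
From mathcomp Require Import zify ring.
(* [point] must not be the one of classical_sets. *)
Import Defs.
Import Order.TTheory GRing.Theory Num.Theory.
Local Open Scope ring_scope.
Set Implicit Arguments.
Unset Strict Implicit.
Unset Printing Implicit Defensive.

(** * Valuations *)

(** The numerical hypothesis says m0 = n + l - 1, and coprimality gives l <= d: the only other case,
    l = d + 1, would mean n = d^2. Hence y, of weight n, fits below m0, while x y and y^2, of
    weights n + d and 2n, do not; this is why a function with divisor m0 (P) - m0 (O) involves y
    only through a constant multiple of y. The polynomial c - B (x - a)^l is linear because it
    divides f with a cofactor of degree (d - 1) l = n - 1, whose leading coefficient contains the
    factor d, invertible in K.

    The order at a point is a choice among the normalized valuations centered there, so nothing can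
    be computed before each place is known to exist and to be unique. Uniqueness serves again for
    isomorphisms: these are only given to match regular functions at corresponding points, and
    uniqueness turns this into equality of orders. Their rationality over K_0 speaks of functions,
    not of points, so the coordinates of the inverse image of Q_d have to be recovered from the
    pullback of an affine function of x. *)

Definition valuation (L : fieldType) (v : L -> int) : Prop :=
  [/\ v 0 = 0,
      forall g h, g != 0 -> h != 0 -> v (g * h) = v g + v h &
      forall g h, g != 0 -> h != 0 -> g + h != 0 ->
        Order.min (v g) (v h) <= v (g + h)].

(* [v g >= k], with the convention [v 0 = +oo]. *)
Definition vge (L : fieldType) (v : L -> int) (k : int) (g : L) : bool :=
  (g == 0) || (k <= v g).

Section ValuationTheory.
Variables (L : fieldType) (v : L -> int).
Hypothesis vv : valuation v.

Lemma valuation0 : v 0 = 0. Proof. by case: vv. Qed.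

Lemma valuationM g h : g != 0 -> h != 0 -> v (g * h) = v g + v h.
Proof. by case: vv => _ vM _; exact: vM. Qed.

Lemma valuation1 : v 1 = 0.
Proof.
have := valuationM (oner_neq0 L) (oner_neq0 L); rewrite mulr1 => /esym/eqP.
by rewrite -subr_eq0 addrK => /eqP.
Qed.

Lemma valuationN g : v (- g) = v g.
Proof.
have [->|g0] := eqVneq g 0; first by rewrite oppr0.
have N1 : v (- 1) = 0.
  have N10 : (- 1 : L) != 0 by rewrite oppr_eq0 oner_neq0.
  by have := valuationM N10 N10; rewrite mulrNN mulr1 valuation1; lia.
by rewrite -mulN1r valuationM ?N1 ?add0r // oppr_eq0 oner_neq0.
Qed.

Lemma valuationX g m : g != 0 -> v (g ^+ m) = v g * m%:Z.
Proof.
move=> g0; elim: m => [|m IH]; first by rewrite expr0 valuation1 mulr0.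
by rewrite exprS valuationM ?expf_neq0 // IH intS mulrDr mulr1.
Qed.

Lemma valuationV g : v g^-1 = - v g.
Proof.
have [->|g0] := eqVneq g 0; first by rewrite invr0 valuation0.
have := valuationM g0 (invr_neq0 g0); rewrite mulfV // valuation1; lia.
Qed.

Lemma vge0 k : vge v k 0. Proof. by rewrite /vge eqxx. Qed.

Lemma vgeD k g h : vge v k g -> vge v k h -> vge v k (g + h).
Proof.
have [->|g0] := eqVneq g 0; first by rewrite add0r.
have [->|h0] := eqVneq h 0; first by rewrite addr0.
rewrite /vge (negPf g0) (negPf h0) /= => kg kh.
have [//|gh0] /= := eqVneq (g + h) 0.
case: vv => _ _ /(_ _ _ g0 h0 gh0); apply: le_trans.
by rewrite le_min kg kh.
Qed.

Lemma vgeN k g : vge v k (- g) = vge v k g.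
Proof. by rewrite /vge oppr_eq0 valuationN. Qed.

Lemma vgeB k g h : vge v k g -> vge v k h -> vge v k (g - h).
Proof. by move=> kg kh; rewrite vgeD ?vgeN. Qed.

Lemma vgeM k l g h : vge v k g -> vge v l h -> vge v (k + l) (g * h).
Proof.
have [->|g0] := eqVneq g 0; first by rewrite mul0r !vge0.
have [->|h0] := eqVneq h 0; first by rewrite mulr0 !vge0.
rewrite /vge (negPf g0) (negPf h0) (negPf (mulf_neq0 g0 h0)) /= valuationM //.
exact: lerD.
Qed.

Lemma vgeW k l g : l <= k -> vge v k g -> vge v l g.
Proof. by rewrite /vge => lk /orP[->//|kg]; rewrite (le_trans lk kg) orbT. Qed.

Lemma vgeE k g : g != 0 -> vge v k g = (k <= v g).
Proof. by rewrite /vge => /negPf->. Qed.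

Lemma vge_sum k (I : Type) (r : seq I) (P : pred I) (F : I -> L) :
  (forall i, P i -> vge v k (F i)) -> vge v k (\sum_(i <- r | P i) F i).
Proof.
by move=> kF; apply: (big_ind (vge v k)) => [||i /kF//]; [exact: vge0 | exact: vgeD].
Qed.

Lemma vgeX g m : vge v 0 g -> vge v 0 (g ^+ m).
Proof.
move=> g0; elim: m => [|m IH]; first by rewrite expr0 /vge valuation1 lexx orbT.
by rewrite exprS -[0]addr0 vgeM.
Qed.

(** Strict case of the ultrametric inequality. Nonvanishing of the sum belongs to the conclusion
    because [v 0 = 0] is only a convention. *)
Lemma val_dom g h : g != 0 -> vge v (v g + 1) h -> g + h != 0 /\ v (g + h) = v g.
Proof.
move=> g0 gh.
have gh0 : g + h != 0.
  apply/negP; rewrite addr_eq0 => /eqP gE.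
  have := gh; rewrite -vgeN -gE vgeE //; lia.
split=> //; have := gh; rewrite /vge; have [->|h0] /= := eqVneq h 0.
  by rewrite addr0.
move=> lt_gh.
have := vgeD (k := v g) (g := g) (h := h).
rewrite !vgeE // lexx => /(_ isT) le1.
have {le1} le1 : v g <= v (g + h) by apply: le1; lia.
apply/eqP; rewrite eq_le le1 andbT leNgt; apply/negP => lt1.
have := vgeB (k := v g + 1) (g := g + h) (h := h).
rewrite addrK !vgeE //; lia.
Qed.

End ValuationTheory.

Definition normalized (L : fieldType) (v : L -> int) : Prop :=
  exists2 t, t != 0 & v t = 1.

(** An element of valuation 1 shows that e divides 1. This fixes the scale once a valuation is known
    up to a factor. *)
Lemma normalized_proportional (L : fieldType) (v w : L -> int) (e : int) :
    normalized v -> 0 <= e -> (forall g, g != 0 -> v g = e * w g) -> e = 1.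
Proof.
move=> [t t0 vt] e0 ve; have := ve t t0; rewrite vt => /esym e1.
have : (e %| 1)%Z by apply/dvdzP; exists (w t); rewrite mulrC e1.
by rewrite dvdz1 => /eqP; lia.
Qed.

(* R is the graph of the valuation on A. *)
Lemma valuation_extension (A : comNzRingType) (L : fieldType)
    (phi : {rmorphism A -> L}) (R : A -> int -> Prop) :
    (forall g, exists u w, phi w != 0 /\ g * phi w = phi u) ->
    (forall u, phi u != 0 -> exists k, R u k) ->
    (forall u w k l, phi u = phi w -> R u k -> R w l -> k = l) ->
    (forall u w k l, R u k -> R w l -> R (u * w) (k + l)) ->
    (forall u w k l m, R u k -> R w l -> R (u + w) m -> Order.min k l <= m) ->
  exists v : L -> int, valuation v /\ (forall u k, phi u != 0 -> R u k -> v (phi u) = k).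
Proof.
move=> frac tot unq mul add.
(* The value of a quotient u / w is the value of u minus that of w; [unq] and [mul] make it
   independent of the representatives. *)
pose S g k := exists u w i j,
  [/\ phi u != 0 /\ phi w != 0, g * phi w = phi u, R u i, R w j & k = i - j].
have Stot g : g != 0 -> exists k, S g k.
  move=> g0; have [u [w [w0 gE]]] := frac g.
  have u0 : phi u != 0 by rewrite -gE mulf_neq0.
  have [i Ri] := tot u u0; have [j Rj] := tot w w0.
  by exists (i - j), u, w, i, j.
have Sunq g k l : S g k -> S g l -> k = l.
  move=> [u [w [i [j [[u0 w0] E Ri Rj ->]]]]].
  move=> [u' [w' [i' [j' [[u0' w0'] E' Ri' Rj' ->]]]]].
  have H : phi (u * w') = phi (u' * w).
    by rewrite !rmorphM /= -E -E'; ring.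
  have := unq _ _ _ _ H (mul _ _ _ _ Ri Rj') (mul _ _ _ _ Ri' Rj); lia.
pose v g := if g == 0 then 0 else xget 0 [set k | S g k]%classic.
have vE g k : g != 0 -> S g k -> v g = k.
  move=> g0 Sk; rewrite /v (negPf g0); case: xgetP => [l _ Sl|/(_ k)//].
  exact: Sunq Sl Sk.
have vS g : g != 0 -> S g (v g).
  by move=> g0; have [k Sk] := Stot g g0; rewrite (vE _ _ g0 Sk).
exists v; split; last first.
  move=> u k u0 Rk; apply: vE => //; have := u0.
  have [j Rj] : exists j, R 1 j by apply: tot; rewrite rmorph1 oner_neq0.
  have j0 : j = 0.
    have := mul _ _ _ _ Rj Rj; rewrite mulr1 => Rjj.
    have := unq _ _ _ _ erefl Rj Rjj; lia.
  exists u, 1, k, j; split=> //; first by rewrite rmorph1 oner_neq0.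
    by rewrite rmorph1 mulr1.
  by rewrite j0 subr0.
split; first by rewrite /v eqxx.
  move=> g h g0 h0.
  have [u [w [i [j [[u0 w0] E Ri Rj ->]]]]] := vS g g0.
  have [u' [w' [i' [j' [[u0' w0'] E' Ri' Rj' ->]]]]] := vS h h0.
  apply: vE; first exact: mulf_neq0.
  exists (u * u'), (w * w'), (i + i'), (j + j'); split; rewrite ?rmorphM ?mulf_neq0 //.
  - by rewrite /= -E -E'; ring.
  - exact: mul.
  - exact: mul.
  - by ring.
move=> g h g0 h0 gh0.
have [u [w [i [j [[u0 w0] E Ri Rj ->]]]]] := vS g g0.
have [u' [w' [i' [j' [[u0' w0'] E' Ri' Rj' ->]]]]] := vS h h0.
have EE : (g + h) * phi (w * w') = phi (u * w' + u' * w).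
  by rewrite rmorphD !rmorphM /= -E -E'; ring.
have ww0 : phi (w * w') != 0 by rewrite rmorphM mulf_neq0.
have uu0 : phi (u * w' + u' * w) != 0 by rewrite -EE mulf_neq0.
have [m Rm] := tot _ uu0.
have := add _ _ _ _ _ (mul _ _ _ _ Ri Rj') (mul _ _ _ _ Ri' Rj) Rm.
rewrite (vE (g + h) (m - (j + j'))) //; first lia.
exists (u * w' + u' * w), (w * w'), m, (j + j'); split=> //; exact: mul.
Qed.

(** * Weights and irreducibility *)

Lemma fracP (R : idomainType) (x : {fraction R}) :
  exists a b : R, b != 0 /\ x * tofrac b = tofrac a.
Proof.
elim/quotW: x => x; exists (frac x).1, (frac x).2; split; first exact: denom_ratioP.
change (FracField.mul (\pi_(FracField.type R) x)%qT (tofrac (frac x).2) = tofrac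
  (frac x).1).
rewrite !piE; apply/eqmodP; rewrite /= FracField.equivfE.
rewrite !numden_Ratio ?(oner_eq0, mulf_neq0, denom_ratioP) //.
by rewrite !mulr1 mulrC.
Qed.

Lemma scale_cons (F : comNzRingType) (q b c : F) (p : {poly F}) :
  (q * b) *: (p * 'X + c%:P) = b%:P * (q *: p) * 'X + q%:P * (c * b)%:P.
Proof. by rewrite -!mul_polyC !polyCM; ring. Qed.

Lemma clear_denom (R : idomainType) (p : {poly {fraction R}}) :
  exists2 q : R, q != 0 & exists u : {poly R}, tofrac q *: p = map_poly (@tofrac R) u.
Proof.
elim/poly_ind: p => [|p c [q q0 [u pE]]].
  by exists 1; [exact: oner_neq0 | exists 0; rewrite scaler0 rmorph0].
have [a [b [b0 cE]]] := fracP c.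
exists (q * b); first by rewrite mulf_neq0.
exists (b%:P * u * 'X + (q * a)%:P).
rewrite rmorphD /= !rmorphM /= map_polyX !map_polyC /= -pE -cE.
exact: scale_cons.
Qed.

HB.instance Definition _ (K : closedFieldType) (f : {poly K}) (d : nat) :=
  GRing.RMorphism.copy (@funxy K f d)
    (in_qpoly _ \o map_poly (@tofrac {poly K})).

(** * Polynomials in x and y with coefficients in K_0 *)

Section Coefficients.
Variables (K : closedFieldType) (K0 : divringClosed K).

(** The outer variable is y and the inner one x: the index j is the exponent of y, and i that of
    x. *)
Definition coefs_in (u : {poly {poly K}}) : Prop :=
  forall i j, (u`_j)`_i \in K0.

Lemma coefs_inP u : u \is a polyOver (polyOver K0) <-> coefs_in u.
Proof.
split=> [/polyOverP uK i j|uK]; first exact/polyOverP/uK.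
by apply/polyOverP => j; apply/(polyOverP (S := K0)) => i; apply: uK.
Qed.

Lemma coefs_inB u w : coefs_in u -> coefs_in w -> coefs_in (u - w).
Proof. by move=> uK wK i j; rewrite !coefB rpredB. Qed.

Lemma coefs_inM u w : coefs_in u -> coefs_in w -> coefs_in (u * w).
Proof.
move=> uK wK i j; rewrite coefM coef_sum rpred_sum // => a _.
by rewrite coefM rpred_sum // => b _; rewrite rpredM.
Qed.

Lemma coefs_inC p : p \is a polyOver K0 -> coefs_in p%:P.
Proof.
move=> /polyOverP pK i j; rewrite coefC; case: ifP => _ //; by rewrite coef0 rpred0.
Qed.

Lemma coefs_inXn k : coefs_in 'X^k.
Proof.
by move=> i j; rewrite coefXn -polyC_natr coefC; case: ifP; rewrite ?rpred0 ?rpred_nat.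
Qed.

End Coefficients.

(** * K(C) as a quotient of K(x)[y] *)

Section FunctionField.
Variables (K : closedFieldType) (f : {poly K}) (d : nat).
Hypotheses (d_gt0 : (0 < d)%N).

Local Notation A := {poly {poly K}}.
Local Notation fxy := (@funxy K f d).
Local Notation eqC := ('X^d - f%:P : A).
Local Notation eqF := (map_poly (@tofrac {poly K}) eqC).

Lemma funxyM u w : fxy (u * w) = fxy u * fxy w. Proof. exact: rmorphM. Qed.

Lemma funxy1 : fxy 1 = 1. Proof. exact: rmorph1. Qed.

Lemma eqC_monic : eqC \is monic.
Proof. by apply: monicXnsubC; exact: d_gt0. Qed.

Lemma eqF_monic : eqF \is monic.
Proof. exact/monic_map/eqC_monic. Qed.

Lemma size_map_tofrac (u : A) : size (map_poly (@tofrac {poly K}) u) = size u.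
Proof. by apply: size_map_inj_poly; rewrite ?rmorph0 // => x y /eqP;
  rewrite tofrac_eq => /eqP. Qed.

Lemma size_eqF : size eqF = d.+1.
Proof. by rewrite size_map_tofrac size_XnsubC. Qed.

(** The quotient type reduces modulo [mk_monic], which substitutes a default for a modulus that is
    constant or not monic; no substitution takes place here. *)
Lemma mk_monic_eqF : mk_monic eqF = eqF.
Proof. by rewrite /mk_monic size_eqF eqF_monic ltnS d_gt0. Qed.

Lemma funxy_multiple (u : A) p : map_poly (@tofrac {poly K}) u = p * eqF -> fxy u = 0.
Proof.
move=> uE; apply/val_inj; rewrite /= mk_monic_eqF uE.
by rewrite Pdiv.RingMonic.rmodp_mull // eqF_monic.
Qed.

Lemma funxy_eqC : fxy eqC = 0.
Proof.
apply/val_inj; rewrite /= mk_monic_eqF.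
by rewrite Pdiv.RingMonic.rmodpp // eqF_monic.
Qed.

(** A polynomial of degree below d in y is its own remainder. This independence of 1, y, ...,
    y^(d-1) is the only injectivity asked of the abstract model. *)
Lemma funxy_inj0 (u : A) : (size u <= d)%N -> fxy u = 0 -> u = 0.
Proof.
move=> su /(congr1 (fun g => polyn g)); rewrite /= Pdiv.CommonRing.rmodp_small;
  last first.
  by rewrite mk_monic_eqF size_eqF size_map_tofrac ltnS.
move=> u0; apply/eqP; rewrite -size_poly_eq0 -size_map_tofrac u0.
by rewrite size_poly0.
Qed.

End FunctionField.

(* L stands for K(C), which is kept abstract so that its construction as a quotient
   is never unfolded. *)
Record curve_model (K : closedFieldType) (f : {poly K}) (d n : nat)
    (L : comNzRingType) (phi : {rmorphism {poly {poly K}} -> L}) : Prop :=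
  CurveModel {
    model_d_gt0 : (0 < d)%N;
    model_size : size f = n.+1;
    model_coprime : coprime n d;
    model_eq : phi ('X^d - f%:P) = 0;
    model_inj : forall u : {poly {poly K}}, (size u <= d)%N -> phi u = 0 -> u = 0
  }.

(** Division by the monic y^d - f takes place over K[x]; the remainder is sent to 0 and has degree
    below d in y, so it vanishes. *)
Lemma model_ker (K : closedFieldType) (f : {poly K}) (d n : nat) (L : comNzRingType)
    (phi : {rmorphism {poly {poly K}} -> L}) : curve_model f d n phi ->
  forall u, phi u = 0 -> exists q, u = q * ('X^d - f%:P).
Proof.
move=> M u u0; have mon : ('X^d - f%:P : {poly {poly K}}) \is monic.
  by apply: eqC_monic; exact: (model_d_gt0 M).
have uE := Pdiv.RingMonic.rdivp_eq mon u.
have sr : (size (Pdiv.CommonRing.rmodp u ('X^d - f%:P)) <= d)%N.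
  by rewrite -ltnS -(size_XnsubC f (model_d_gt0 M)) Pdiv.CommonRing.ltn_rmodp monic_neq0.
have r0 : Pdiv.CommonRing.rmodp u ('X^d - f%:P) = 0.
  apply: (model_inj M sr); move: u0.
  by rewrite {1}uE rmorphD rmorphM (model_eq M) mulr0 add0r.
by exists (Pdiv.CommonRing.rdivp u ('X^d - f%:P)); rewrite {1}uE r0 addr0.
Qed.

Section Weight.
Variables (K : closedFieldType) (f : {poly K}) (d n : nat).
Local Notation A := {poly {poly K}}.
Local Notation eqC := ('X^d - f%:P : A).
Variables (L : comNzRingType) (phi : {rmorphism A -> L}).
Hypothesis M : curve_model f d n phi.
Let d_gt0 := model_d_gt0 M.
Let sf := model_size M.
Let cop := model_coprime M.
Let phi_eqC := model_eq M.
Let phi_inj := model_inj M.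

(* x^i y^j has weight d * i + n * j, its pole order at infinity. *)
Definition wlt (k : nat) (u : A) : Prop :=
  forall i j, (u`_j)`_i != 0 -> (d * i + n * j < k)%N.

Definition mono (c : K) (i j : nat) : A := (c *: 'X^i)%:P * 'X^j.

Lemma coef_mono c i j i' j' :
  ((mono c i j)`_j')`_i' = if (i' == i) && (j' == j) then c else 0.
Proof.
rewrite /mono coefCM coefXn; case: eqVneq => _; rewrite ?mulr0 ?coef0 ?andbF //.
by rewrite mulr1 coefZ coefXn andbT; case: eqP; rewrite ?mulr1 ?mulr0.
Qed.

Lemma wlt_mono c i j k : (d * i + n * j < k)%N -> wlt k (mono c i j).
Proof.
by move=> ltk i' j'; rewrite coef_mono; case: andP => [[/eqP-> /eqP->]|]; rewrite ?eqxx.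
Qed.

Lemma wlt0 k : wlt k 0.
Proof. by move=> i j; rewrite !coef0 eqxx. Qed.

Lemma wltD k u w : wlt k u -> wlt k w -> wlt k (u + w).
Proof.
move=> ku kw i j; rewrite !coefD; have [u0|/ku//] := eqVneq ((u`_j)`_i) 0.
by rewrite u0 add0r => /kw.
Qed.

Lemma wltN k u : wlt k u -> wlt k (- u).
Proof. by move=> ku i j; rewrite !coefN oppr_eq0 => /ku. Qed.

Lemma wltB k u w : wlt k u -> wlt k w -> wlt k (u - w).
Proof. by move=> ku kw; apply/wltD/wltN. Qed.

Lemma wltW k l u : (k <= l)%N -> wlt k u -> wlt l u.
Proof. by move=> kl ku i j /ku/leq_trans; apply. Qed.

(** The bounds are asymmetric, at most k and less than l, to fit the product of a leading monomial
    and a remainder. *)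
Lemma wltM k l u w : wlt k.+1 u -> wlt l w -> wlt (k + l) (u * w).
Proof.
move=> ku lw i j; apply: contraNT; rewrite -leqNgt => le_kl.
rewrite coefM coef_sum big1 // => a _; rewrite coefM big1 // => b _.
have [->|/ku lt1] := eqVneq ((u`_a)`_b) 0; first by rewrite mul0r.
have [->|/lw lt2] := eqVneq ((w`_(j - a))`_(i - b)) 0; first by rewrite mulr0.
have := ltn_ord a; have := ltn_ord b; move: lt1 lt2 le_kl.
have := mulnBr d i b; have := mulnBr n j a.
have : (b <= i -> d * b <= d * i)%N by move=> ?; rewrite leq_mul2l; apply/orP; right.
have : (a <= j -> n * a <= n * j)%N by move=> ?; rewrite leq_mul2l; apply/orP; right.
move: (n * a)%N (n * j)%N (n * (j - a))%N (d * b)%N (d * i)%N (d * (i - b))%N.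
lia.
Qed.

Lemma wlt_ex u : exists k, wlt k u.
Proof.
pose m := \max_(j < size u) size (u`_j)%R.
exists (d * m + n * size u).+1 => i j cu.
have sj : (j < size u)%N.
  by rewrite ltnNge; apply: contraNN cu => sj; rewrite (nth_default 0 sj) coef0.
have si : (i < size (u`_j)%R)%N.
  by rewrite ltnNge; apply: contraNN cu => si; rewrite nth_default.
have jm : (size (u`_j)%R <= m)%N.
  exact: (@leq_bigmax _ (fun j : 'I_(size u) => size (u`_j)%R) (Ordinal sj)).
by rewrite ltnS leq_add // leq_mul2l ?(ltnW sj) ?(leq_trans (ltnW si)) ?orbT.
Qed.

(** Replacing y^d by f does not raise weights: y^d and x^n both have weight d n. *)
Lemma wlt_subst k p m : wlt k (p%:P * 'X^(m + d)) -> wlt k ((p * f)%:P * 'X^m).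
Proof.
move=> kp i j; rewrite coefCM coefXn; case: (eqVneq j m) => [->|_]; last
  by rewrite mulr0 coef0 eqxx.
rewrite mulr1 coefM => /eqP s0.
have [a pf0] : exists a : 'I_i.+1, p`_a * f`_(i - a) != 0.
  apply/existsP; apply: contraPT s0; rewrite negb_exists => /forallP H; apply.
  by apply: big1 => a _; apply/eqP; rewrite -[_ == _]negbK H.
move: pf0; rewrite mulf_eq0 negb_or => /andP[pa fa].
have := kp a (m + d)%N; rewrite coefCM coefXn eqxx mulr1 => /(_ pa).
have : (i - a <= n)%N.
  by rewrite -ltnS -sf ltnNge; apply: contraNN fa => ?; rewrite nth_default.
have := ltn_ord a; rewrite ltnS => ai lin; apply: leq_trans; rewrite ltnS.
have : (d * (i - a) <= d * n)%N by rewrite leq_mul2l lin orbT.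
rewrite mulnBr mulnDr (mulnC n d).
have : (d * a <= d * i)%N by rewrite leq_mul2l ai orbT.
lia.
Qed.

(** The top power of y is removed by y^d = f until the degree in y is below d. The clause on K_0 is
    what later lets affine functions descend to K_0. *)
Lemma wlt_reduce k u : wlt k u ->
  exists r : A, [/\ (size r <= d)%N, wlt k r, phi r = phi u &
    forall K0 : divringClosed K, f \is a polyOver K0 -> coefs_in K0 u ->
      coefs_in K0 r].
Proof.
have [s] := ubnP (size u); elim: s u => // s IH u; rewrite ltnS => su ku.
have [sd|ds] := leqP (size u) d; first by exists u.
have [m sE] : exists m, size u = m.+1 by exists (size u).-1; case: (size u) ds.
rewrite sE in su ds; have md : (d <= m)%N by [].
set a := u`_m.
pose u' := u - a%:P * 'X^m + (a * f)%:P * 'X^(m - d).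
have u'E : u' = u - a%:P * 'X^(m - d) * eqC.
  rewrite /u' -{1}(subnK md) exprD polyCM; ring.
have ka : wlt k (a%:P * 'X^m).
  move=> i j; rewrite coefCM coefXn; case: (eqVneq j m) => [->|_]; last
    by rewrite mulr0 coef0 eqxx.
  by rewrite mulr1 => /ku.
have su' : (size u' < s)%N.
  apply: (@leq_ltn_trans m) => //.
  apply/leq_sizeP => j mj; rewrite /u' !coefD coefN !coefCM !coefXn.
  rewrite (_ : (j == m - d)%N = false) ?mulr0 ?addr0; last by apply/negP; lia.
  case: eqVneq => [->|jm]; first by rewrite mulr1 subrr.
  by rewrite mulr0 subr0 nth_default // sE; lia.
have ku' : wlt k u'.
  apply: wltD; first exact: wltB.
  by apply: wlt_subst; rewrite subnK.
have [r [rs rk rE rK]] := IH u' su' ku'.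
exists r; split=> //.
  by rewrite rE u'E rmorphB rmorphM phi_eqC mulr0 subr0.
move=> K0 fK uK; apply: rK => //; rewrite u'E.
apply: coefs_inB => //; apply: coefs_inM.
  by apply: coefs_inM; [apply/coefs_inC/polyOverP => i; apply: uK | exact: coefs_inXn].
by apply: coefs_inB; [exact: coefs_inXn | exact: coefs_inC].
Qed.

Definition wt (g : L) (k : nat) : Prop :=
  exists c i j u, [/\ c != 0, (d * i + n * j)%N = k, wlt k u & g = phi (mono c i j + u)].

Lemma f_lead : exists2 f', f = lead_coef f *: 'X^n + f' & (size f' <= n)%N.
Proof.
exists (f - lead_coef f *: 'X^n); first by rewrite addrC subrK.
apply/leq_sizeP => j nj; rewrite coefB coefZ coefXn lead_coefE sf /=.
have [->|jn] := eqVneq j n; first by rewrite mulr1 subrr.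
by rewrite mulr0 subr0 nth_default // sf; lia.
Qed.

Lemma f_neq0 : f != 0.
Proof. by rewrite -size_poly_gt0 sf. Qed.

(** Each step trades y^d for the leading term of f, of equal weight; the other terms of f contribute
    lower weights, collected in u'. *)
Lemma mono_reduce c i j : c != 0 -> exists c' i' j' u',
  [/\ c' != 0, (j' < d)%N, (d * i' + n * j' = d * i + n * j)%N,
      wlt (d * i + n * j) u' & phi (mono c i j) = phi (mono c' i' j' + u')].
Proof.
have [s] := ubnP j; elim: s i j c => // s IH i j c; rewrite ltnS => js c0.
have [jd|dj] := ltnP j d.
  by exists c, i, j, 0; split=> //; [exact: wlt0 | rewrite addr0].
have [f' fE sf'] := f_lead.
have wE : (d * (i + n) + n * (j - d) = d * i + n * j)%N.
  have := leq_mul2l n d j; rewrite dj orbT mulnBr mulnDr (mulnC n d); lia.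
have js' : (j - d < s)%N by lia.
have cf : c * lead_coef f != 0 by rewrite mulf_neq0 // lead_coef_eq0 f_neq0.
have [c' [i' [j' [u' [c'0 jd' w' ku' E]]]]] := IH (i + n)%N (j - d)%N _ js' cf.
exists c', i', j', (u' + (c *: 'X^i * f')%:P * 'X^(j - d)); split=> //.
- by rewrite w' wE.
- apply: wltD; first by rewrite -wE.
  move=> a b; rewrite coefCM coefXn; case: (eqVneq b (j - d)%N) => [->|_]; last
    by rewrite mulr0 coef0 eqxx.
  rewrite mulr1 -scalerAl coefZ coefXnM; case: ltnP => [_|ia]; first
    by rewrite mulr0 eqxx.
  rewrite mulf_eq0 negb_or => /andP[_ fa].
  have : (a - i < n)%N.
    by rewrite ltnNge; apply: contraNN fa => ?; rewrite nth_default // (leq_trans sf').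
  have : (n * d <= n * j)%N by rewrite leq_mul2l dj orbT.
  rewrite mulnBr => ? ltn; have : (d * (a - i) < d * n)%N by rewrite ltn_mul2l d_gt0.
  rewrite mulnBr (mulnC d n).
  have : (d * i <= d * a)%N by rewrite leq_mul2l ia orbT.
  lia.
rewrite addrA rmorphD -E -rmorphD; apply/eqP; rewrite -subr_eq0 -rmorphB.
rewrite (_ : _ - _ = (c *: 'X^i)%:P * 'X^(j - d) * eqC); first
  by rewrite rmorphM phi_eqC mulr0.
have fE2 : f%:P = (lead_coef f *: 'X^n + f')%:P :> A by rewrite -fE.
rewrite [in RHS]fE2 /mono -{1}(subnK dj) !exprD; move: (lead_coef f) => l.
by rewrite -!mul_polyC !polyCD !polyCM; ring.
Qed.

(* Modulo y^d = f, a monomial reduces to one with exponent of y below d and the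
   same weight; as n is prime to d, distinct such monomials have distinct weights. *)
Lemma wt_nwlt u k : wt (phi u) k -> ~ wlt k u.
Proof.
move=> [c [i [j [u' [c0 wE ku' gE]]]]] ku.
have [c' [i' [j' [w' [c'0 jd w'E kw' E]]]]] := mono_reduce i j c0.
rewrite wE in w'E kw'.
(* This difference represents the same function as the reduced monomial; after reduction it must be
   equal to it, although its weights are below k. *)
have kr : wlt k (u - u' - w') by apply: wltB => //; apply: wltB.
have [r [rd kr' rE _]] := wlt_reduce kr.
have rm : mono c' i' j' - r = 0.
  apply: phi_inj.
    apply: (leq_trans (size_polyD _ _)); rewrite size_polyN geq_max rd andbT.
    apply/leq_sizeP => l dl; rewrite coefCM coefXn.
    by rewrite (_ : (l == j') = false) ?mulr0 //; apply/negbTE; lia.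
  by rewrite rmorphB rE !rmorphB gE rmorphD E rmorphD; ring.
have := kr' i' j'; move/eqP: rm; rewrite subr_eq0 => /eqP<-.
by rewrite coef_mono !eqxx w'E ltnn => /(_ c'0).
Qed.

Lemma wt_neq0 g k : wt g k -> g != 0.
Proof.
move=> gk; apply/eqP => g0; rewrite g0 -(rmorph0 phi) in gk.
by apply: (wt_nwlt gk); exact: wlt0.
Qed.

Lemma wtM g h k l : wt g k -> wt h l -> wt (g * h) (k + l).
Proof.
move=> [c [i [j [u [c0 wE ku ->]]]]] [c' [i' [j' [u' [c0' wE' ku' ->]]]]].
exists (c * c'), (i + i')%N, (j + j')%N.
exists (mono c i j * u' + u * (mono c' i' j' + u')); split; first exact: mulf_neq0.
- by rewrite !mulnDr -wE -wE'; lia.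
- apply: wltD; first by apply: wltM => //; apply: wlt_mono; rewrite wE.
  rewrite mulrC addnC; apply: wltM => //; apply: wltD.
    by apply: wlt_mono; rewrite wE'.
  by apply: wltW ku'.
rewrite -rmorphM; congr (phi _); rewrite mulrDl [in LHS]mulrDr addrA.
congr (_ + _ + _).
rewrite /mono -!mul_polyC !exprD !polyCM; ring.
Qed.

Lemma wt_wlt u k : wt (phi u) k -> exists2 w, wlt k.+1 w & phi w = phi u.
Proof.
move=> [c [i [j [u' [c0 wE ku' ->]]]]]; exists (mono c i j + u') => //.
by apply: wltD; [apply: wlt_mono; rewrite wE | apply: wltW ku'].
Qed.

Lemma wt_le u w k l : wt (phi u) k -> wlt l w -> phi w = phi u -> (k < l)%N.
Proof.
move=> uk lw E; rewrite ltnNge; apply/negP => lk.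
by rewrite -E in uk; apply: (wt_nwlt uk); apply: wltW lw.
Qed.

Lemma wt_unique u w k l : phi u = phi w -> wt (phi u) k -> wt (phi w) l -> k = l.
Proof.
move=> E uk wl; have [u' ku' Eu] := wt_wlt uk; have [w' lw' Ew] := wt_wlt wl.
have := wt_le uk lw' (etrans Ew (esym E)); have := wt_le wl ku' (etrans Eu E).
lia.
Qed.

Lemma wt_add u w k l m : wt (phi u) k -> wt (phi w) l -> wt (phi (u + w)) m ->
  (m <= maxn k l)%N.
Proof.
move=> uk wl uwm; have [u' ku' Eu] := wt_wlt uk; have [w' lw' Ew] := wt_wlt wl.
have := @wt_le _ (u' + w') _ (maxn k l).+1 uwm; rewrite !rmorphD Eu Ew ltnS; apply=> //.
by apply: wltD; [apply: wltW ku' | apply: wltW lw']; rewrite ltnS ?leq_maxl ?leq_maxr.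
Qed.

Lemma weight_inj i j i' j' : (j < d)%N -> (j' < d)%N ->
  (d * i + n * j = d * i' + n * j')%N -> i = i' /\ j = j'.
Proof.
wlog jj' : i j i' j' / (j <= j')%N => [H|] jd jd' E.
  have [/H|/ltnW/H H'] := leqP j j'; first exact.
  by have [] := H' _ _ jd' jd (esym E).
have ji : (i' <= i)%N.
  rewrite leqNgt; apply/negP => lti.
  have : (d * i < d * i')%N by rewrite ltn_mul2l d_gt0.
  have : (n * j <= n * j')%N by rewrite leq_mul2l jj' orbT.
  lia.
have E2 : (d * (i - i') = n * (j' - j))%N by rewrite !mulnBr; lia.
have : (d %| j' - j)%N.
  by rewrite -(Gauss_dvdr (m := d) (n := n)) ?(coprime_sym d) // -E2 dvdn_mulr.
have [jE _|ne /dvdn_leq] := eqVneq (j' - j)%N 0%N; last lia.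
move: E2; rewrite jE muln0 => /eqP; rewrite muln_eq0; lia.
Qed.

(** In a reduced representative the largest weight is reached by a single monomial, by [weight_inj],
    and this monomial leads. *)
Lemma wt_ex u : phi u != 0 -> exists k, wt (phi u) k.
Proof.
move=> u0; have [k ku] := wlt_ex u; have [r [rd {}ku rE _]] := wlt_reduce ku.
move: u0; rewrite -rE => r0 {rE u}.
have [k' [k1 nk]] : exists k, wlt k.+1 r /\ ~ wlt k r.
  elim: k ku => [k0|k IH ku]; last first.
    by have [/IH//|nk] := pselect (wlt k r); exists k.
  case/negP: r0; rewrite (_ : r = 0) ?rmorph0 //.
  apply/polyP => j; apply/polyP => i; rewrite !coef0; apply/eqP.
  by apply: contraT => /k0.
move/existsNP: nk => [i /existsNP[j /not_implyP[rij /negP]]]; rewrite -leqNgt => kij.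
have wE : (d * i + n * j = k')%N by apply/eqP; rewrite eqn_leq kij -ltnS k1.
exists k', ((r`_j)`_i), i, j, (r - mono ((r`_j)`_i) i j); split=> //; last first.
  by rewrite addrC subrK.
move=> i' j'; rewrite coefB coefB coef_mono => nz.
have r'0 : (r`_j')`_i' != 0.
  by apply: contraNN nz; case: andP => [[/eqP-> /eqP->]|_ /eqP->];
    rewrite ?subrr ?subr0 ?eqxx.
have jd a b : (r`_b)`_a != 0 -> (b < d)%N.
  by apply: contraNT; rewrite -leqNgt => /(leq_trans rd) db;
    rewrite [r`_b]nth_default // coef0.
have := k1 _ _ r'0; rewrite ltnS leq_eqVlt => /orP[/eqP w'E|//].
have [ii jj] := weight_inj (jd _ _ r'0) (jd _ _ rij) (etrans w'E (esym wE)).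
by move: nz; rewrite ii jj !eqxx subrr eqxx.
Qed.

End Weight.

Section Irreducible.
Variables (K : closedFieldType) (f : {poly K}) (d n : nat).
Hypotheses (d_gt0 : (0 < d)%N) (sf : size f = n.+1) (cop : coprime n d).
Local Notation A := {poly {poly K}}.
Local Notation fxy := (@funxy K f d).
Local Notation eqF := (map_poly (@tofrac {poly K}) ('X^d - f%:P : A)).
Local Opaque funxy.

(** After clearing denominators, a proper factorization would give two nonzero functions with
    product 0; but both have a weight, weights add, and a function with a weight is nonzero. The
    argument runs before K(C) is known to be a field, which is why [curve_model] only asks for a
    commutative ring. *)
Lemma eqF_irreducible : monic_irreducible_poly eqF.
Proof.
split; last exact: (eqF_monic f d_gt0).
split; first by rewrite (size_eqF f d_gt0) ltnS.
move=> q q1 qE.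
have eq0 : eqF != 0 by rewrite monic_neq0 // (eqF_monic f d_gt0).
have q0 : q != 0 by apply: dvdpN0 qE _.
rewrite -(dvdp_size_eqp qE) (size_eqF f d_gt0); apply/negPn/negP => qd.
have sq : (size q <= d)%N.
  by have := dvdp_leq eq0 qE; rewrite (size_eqF f d_gt0) leq_eqVlt (negPf qd).
have /dvdpP[s sE] := qE.
have s0 : s != 0 by apply: contraNneq eq0 => s0; rewrite sE s0 mul0r.
have ss : (size s <= d)%N.
  have := size_mul s0 q0; rewrite -sE (size_eqF f d_gt0).
  have : (1 < size q)%N by rewrite ltn_neqAle eq_sym q1 size_poly_gt0.
  by move: (size s) (size q) => a b; clear; lia.
have red (p : {poly {fraction {poly K}}}) : p != 0 -> (size p <= d)%N -> exists2 a, a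
  != 0 &
    exists u : A, [/\ fxy u != 0 & tofrac a *: p = map_poly (@tofrac {poly K}) u].
  move=> p0 pd; have [a a0 [u uE]] := clear_denom p; exists a => //; exists u; split=> //.
  apply/eqP => u0.
  have su : (size u <= d)%N.
    have <- : size (tofrac a *: p) = size u.
      exact: (etrans (congr1 (fun p => size (polyseq p)) uE) (size_map_tofrac u)).
    by rewrite size_scale ?tofrac_eq0.
  move: uE; rewrite (funxy_inj0 d_gt0 su u0) rmorph0 => /eqP.
  by rewrite scaler_eq0 tofrac_eq0 (negPf a0) (negPf p0).
have [a a0 [u [u0 uE]]] := red q q0 sq.
have [b b0 [w [w0 wE]]] := red s s0 ss.
have M : curve_model f d n (@funxy K f d).
  by split=> //; [exact: funxy_eqC | exact: funxy_inj0].
have [k uk] := wt_ex M u0; have [l wl] := wt_ex M w0.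
have /eqP[] := wt_neq0 M (wtM M uk wl).
rewrite -funxyM; apply: (@funxy_multiple _ _ _ d_gt0 _ (tofrac (a * b))%:P).
transitivity ((tofrac a *: q) * (tofrac b *: s)).
  by rewrite uE wE; exact: rmorphM.
by rewrite sE -scalerAl -scalerAr scalerA mul_polyC -rmorphM (mulrC q).
Qed.

End Irreducible.

(** * The place at infinity *)

(** Denominators can be taken in K[x] since K(C) is a quotient of K(x)[y]. They bound orders at
    affine points and carry the descent to regular functions. *)
Record smooth_model (K : closedFieldType) (f : {poly K}) (d n : nat)
    (L : fieldType) (phi : {rmorphism {poly {poly K}} -> L}) : Prop :=
  SmoothModel {
    smooth_model_model : curve_model f d n phi;
    smooth_model_frac : forall g : L, exists2 q : {poly K}, q != 0 &
      exists u : {poly {poly K}}, g * phi q%:P = phi u;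
    smooth_model_d_gt1 : (1 < d)%N;
    smooth_model_char : d%:R != 0 :> K;
    smooth_model_sqfree : no_repeated_roots f
  }.

Section Places.
Variables (K : closedFieldType) (L : fieldType).
Local Notation A := {poly {poly K}}.
Variable phi : {rmorphism A -> L}.

Definition kvaluation (v : L -> int) : Prop :=
  [/\ valuation v, forall c : K, v (phi c%:P%:P) = 0 & normalized v].

Definition centered_at (P : option (K * K)) (v : L -> int) : Prop :=
  if P is Some (a, b) then
    0 < v (phi 'X%:P - phi a%:P%:P) /\ 0 < v (phi 'X - phi b%:P%:P)
  else v (phi 'X%:P) < 0.

Definition at_point (P : K * K) (u : A) : K := (u.[P.2%:P]).[P.1].

Lemma at_pointB P u w : at_point P (u - w) = at_point P u - at_point P w.
Proof. by rewrite /at_point !hornerD !hornerN. Qed.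

Lemma at_pointD P u w : at_point P (u + w) = at_point P u + at_point P w.
Proof. by rewrite /at_point !hornerD. Qed.

Lemma at_pointM P u w : at_point P (u * w) = at_point P u * at_point P w.
Proof. by rewrite /at_point !hornerM. Qed.

Lemma at_pointXn P u k : at_point P (u ^+ k) = at_point P u ^+ k.
Proof. by rewrite /at_point !horner_exp. Qed.

Lemma at_pointC P p : at_point P p%:P = p.[P.1].
Proof. by rewrite /at_point hornerC. Qed.

Lemma at_pointX P : at_point P 'X = P.2.
Proof. by rewrite /at_point hornerX hornerC. Qed.

Lemma centered_atE (P : K * K) v : centered_at (Some P) v <->
  0 < v (phi ('X - P.1%:P)%:P) /\ 0 < v (phi ('X - P.2%:P%:P)).
Proof. by case: P => a b /=; rewrite polyCB !rmorphB. Qed.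

End Places.

Section Infinity.
Variables (K : closedFieldType) (f : {poly K}) (d n : nat) (L : fieldType).
Local Notation A := {poly {poly K}}.
Variable phi : {rmorphism A -> L}.
Hypothesis S : smooth_model f d n phi.
Let M := smooth_model_model S.

Lemma phi_frac (g : L) : exists u w, phi w != 0 /\ g * phi w = phi u.
Proof.
have [q q0 [u gE]] := smooth_model_frac S g; exists u, q%:P; split=> //.
apply: contraNneq q0 => qp0; rewrite -polyC_eq0; apply/eqP/(model_inj M) => //.
by rewrite (leq_trans (size_polyC_leq1 _)) // (model_d_gt0 M).
Qed.

Lemma proportional_ext v w e : valuation v -> valuation w ->
  (forall u, phi u != 0 -> v (phi u) = e * w (phi u)) ->
  forall g, g != 0 -> v g = e * w g.
Proof.
move=> vv ww E g g0; have [u [u' [u'0 gE]]] := phi_frac g.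
have u0 : phi u != 0 by rewrite -gE mulf_neq0.
have := E _ u0; rewrite -gE valuationM // valuationM // (E _ u'0) mulrDr.
exact: addIr.
Qed.

Lemma valuation_ext v w : valuation v -> valuation w ->
  (forall u, phi u != 0 -> v (phi u) = w (phi u)) -> v = w.
Proof.
move=> vv ww E; apply/funext => g; have [->|g0] := eqVneq g 0.
  by rewrite !valuation0.
rewrite (proportional_ext (e := 1) vv ww) ?mul1r // => u u0.
by rewrite mul1r E.
Qed.

Lemma phiXd : phi 'X ^+ d = phi f%:P.
Proof. by apply/eqP; rewrite -subr_eq0 -rmorphXn -rmorphB (model_eq M). Qed.

Lemma phiC_eq0 (p : {poly K}) : (phi p%:P == 0) = (p == 0).
Proof.
apply/eqP/eqP => [p0|->]; last by rewrite polyC0 rmorph0.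
apply/eqP; rewrite -polyC_eq0; apply/eqP/(model_inj M) => //.
by rewrite (leq_trans (size_polyC_leq1 _)) // (model_d_gt0 M).
Qed.

Lemma phiX_neq0 : phi 'X != 0.
Proof.
have : phi 'X ^+ d != 0.
  by rewrite phiXd phiC_eq0 -size_poly_gt0 (model_size M).
by rewrite expf_eq0 (model_d_gt0 M).
Qed.

Lemma phi_mono c i j : phi (mono c i j) =
  phi c%:P%:P * phi 'X%:P ^+ i * phi 'X ^+ j.
Proof. by rewrite /mono -mul_polyC polyCM [('X^i)%:P]rmorphXn !rmorphM !rmorphXn. Qed.

Lemma mono_wt c i j : c != 0 -> wt d n phi (phi (mono c i j)) (d * i + n * j).
Proof.
by move=> c0; exists c, i, j, 0; split=> //; [exact: wlt0 | rewrite addr0].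
Qed.

Lemma val_infty_exists : exists v, [/\ kvaluation phi v, centered_at phi None v &
  forall g k, wt d n phi g k -> v g = - k%:Z].
Proof.
pose R u (k : int) := exists2 l, wt d n phi (phi u) l & k = - l%:Z.
have [|u u0|u w k l E [i ui ->] [j wj ->]|u w k l [i ui ->] [j wj ->]|
   u w k l m [i ui ->] [j wj ->] [t ut ->]|v [vv vE]] :=
    @valuation_extension A L phi R.
- exact: phi_frac.
- by have [l ul] := wt_ex M u0; exists (- l%:Z), l.
- by rewrite (wt_unique M E ui wj).
- by exists (i + j)%N; [rewrite rmorphM; exact: (wtM M) | rewrite PoszD opprD].
- have := wt_add M ui wj ut; lia.
have vE' g k : wt d n phi g k -> v g = - k%:Z.
  move=> gk; have gk' := gk; move: gk => [c [i [j [u [_ _ _ gE]]]]].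
  have g0 := wt_neq0 M gk'; rewrite gE in gk' g0 *.
  by apply: vE => //; exists k.
have vX : v (phi 'X%:P) = - d%:Z.
  rewrite (_ : 'X%:P = mono 1 1 0) ?(vE' _ _ (mono_wt _ _ (oner_neq0 _))) ?muln1
    ?muln0 ?addn0 //.
  by rewrite /mono scale1r expr1 expr0 mulr1.
have vY : v (phi 'X) = - n%:Z.
  rewrite (_ : 'X = mono 1 0 1) ?(vE' _ _ (mono_wt _ _ (oner_neq0 _))) ?muln1 ?muln0
    ?add0n //.
  by rewrite /mono scale1r expr1 expr0 mul1r.
exists v; split=> //; last by rewrite /= vX oppr_lt0 ltz_nat (model_d_gt0 M).
split=> // [c|].
  have [->|c0] := eqVneq c 0; first by rewrite !polyC0 rmorph0; case: vv.
  rewrite (_ : c%:P%:P = mono c 0 0) ?(vE' _ _ (mono_wt _ _ c0)) ?muln0 //.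
  by rewrite /mono -mul_polyC !expr0 !mulr1.
have X0 : phi 'X%:P != 0 by rewrite phiC_eq0 polyX_eq0.
(* As n is prime to d, there are a and b with n a = d b + 1, and x^b / y^a has valuation n a - d b =
   1. *)
have [[a b] /= ab] : exists ab : nat * nat, (n * ab.1 = d * ab.2 + 1)%N.
  have n0 : (0 < n)%N.
    rewrite lt0n; apply/eqP => n0; have := model_coprime M;
      rewrite n0 /coprime gcd0n => /eqP d1.
    by have := smooth_model_d_gt1 S; rewrite d1.
  case: (egcdnP d n0) => a b E _; exists (a, b) => /=.
  have := model_coprime M; rewrite /coprime => /eqP g1; rewrite mulnC E g1; lia.
exists (phi 'X%:P ^+ b / phi 'X ^+ a).
  by rewrite mulf_neq0 ?invr_neq0 ?expf_neq0 // phiX_neq0.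
rewrite valuationM ?invr_neq0 ?expf_neq0 ?phiX_neq0 // valuationV // !valuationX
  ?phiX_neq0 // vX vY.
by move: ab; clear; lia.
Qed.

Section Unique.
Variable v : L -> int.
Hypotheses (vk : kvaluation phi v) (vc : centered_at phi None v).
Let vv : valuation v. Proof. by case: vk. Qed.

(* d v(y) = n v(x) and n is prime to d, so that v(x) = - e d and v(y) = - e n. *)
Lemma val_infty_scale : exists2 e : int, 0 <= e &
  forall g k, wt d n phi g k -> v g = - (e * k%:Z).
Proof.
have [_ vC _] := vk.
have X0 : phi 'X%:P != 0 by rewrite phiC_eq0 polyX_eq0.
pose x := v (phi 'X%:P); pose y := v (phi 'X).
have vm c i j : c != 0 -> v (phi (mono c i j)) = x * i%:Z + y * j%:Z.
  move=> c0; have C0 : phi c%:P%:P != 0 by rewrite phiC_eq0 polyC_eq0.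
  rewrite phi_mono valuationM ?mulf_neq0 ?expf_neq0 ?phiX_neq0 // valuationM
    ?expf_neq0 //.
  by rewrite !valuationX ?phiX_neq0 // vC add0r.
have x0 : x < 0 := vc.
(* As v(x) < 0, the leading term of f has strictly the least valuation. *)
have vf : v (phi f%:P) = x * n%:Z.
  have [f' fE sf'] := f_lead M.
  have c0 : lead_coef f != 0 by rewrite lead_coef_eq0 (f_neq0 M).
  have mE : phi (lead_coef f *: 'X^n)%:P = phi (mono (lead_coef f) n 0).
    by rewrite /mono expr0 mulr1.
  have E : v (phi (mono (lead_coef f) n 0)) = x * n%:Z by rewrite vm // mulr0 addr0.
  rewrite {1}fE polyCD rmorphD mE.
  have m0 : phi (mono (lead_coef f) n 0) != 0.
    by rewrite -mE phiC_eq0 scaler_eq0 negb_or c0 monic_neq0 ?monicXn.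
  have [//|_ ->//] := val_dom vv m0 (h := phi f'%:P).
  rewrite E -[f']coefK poly_def rmorph_sum rmorph_sum; apply: vge_sum => // i _.
  have [->|ci] := eqVneq f'`_i 0; first by rewrite scale0r !rmorph0 vge0.
  rewrite [X in phi X](_ : _ = mono f'`_i i 0); last by rewrite /mono expr0 mulr1.
  rewrite /vge vm // mulr0 addr0; apply/orP; right.
  have : (i < n)%N by apply: leq_trans sf'.
  have aux (z : int) (a b : nat) : z < 0 -> (a < b)%N -> z * b%:Z + 1 <= z * a%:Z by nia.
  by move/(aux _ _ _ x0).
have dy : y * d%:Z = x * n%:Z.
  by rewrite -vf -phiXd valuationX ?phiX_neq0 //.
have /dvdzP[e' xE] : (d%:Z %| x)%Z.
  have : (d%:Z %| x * n%:Z)%Z by rewrite -dy dvdz_mull.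
  by rewrite mulrC Gauss_dvdzr // coprimezE !absz_nat coprime_sym (model_coprime M).
have d0 : d%:Z != 0 by have := model_d_gt0 M; lia.
have yE : y = e' * n%:Z.
  by apply: (mulIf d0); rewrite dy xE; ring.
have e'0 : e' <= 0.
  by have := model_d_gt0 M; move: x0; rewrite xE; nia.
exists (- e'); first lia.
move=> g k [c [i [j [u [c0 wE ku ->]]]]].
have E : v (phi (mono c i j)) = - (- e' * k%:Z).
  by rewrite vm // xE yE -wE !PoszD !PoszM; ring.
have m0 : phi (mono c i j) != 0.
  rewrite phi_mono ?mulf_neq0 ?expf_neq0 ?phiX_neq0 //.
  by rewrite phiC_eq0 polyC_eq0.
have e0 : e' < 0.
  by have := model_d_gt0 M; move: x0; rewrite xE; nia.
rewrite rmorphD; have [|_ ->//] := val_dom vv m0 (h := phi u).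
rewrite E -[u]coefK poly_def rmorph_sum; apply: vge_sum => // j' _.
rewrite -mul_polyC -[u`_j']coefK poly_def rmorph_sum mulr_suml rmorph_sum.
apply: vge_sum => // i' _; have [->|ci] := eqVneq (u`_j')`_i' 0.
  by rewrite scale0r rmorph0 mul0r rmorph0 vge0.
rewrite [X in phi X](_ : _ = mono (u`_j')`_i' i' j') // /vge vm //; apply/orP; right.
have := ku _ _ ci; rewrite xE yE; nia.
Qed.

(** By [val_infty_scale], v is e times the valuation constructed from weights, and normalization
    leaves only e = 1. *)
Lemma val_infty_wt g k : wt d n phi g k -> v g = - k%:Z.
Proof.
have [e e0 ve] := val_infty_scale; have [w [[ww _ _] wc wE]] := val_infty_exists.
have [_ _ vn] := vk.
have e1 : e = 1.
  apply: (normalized_proportional vn e0); apply: (proportional_ext vv ww) => u u0.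
  by have [l ul] := wt_ex M u0; rewrite (ve _ _ ul) (wE _ _ ul) mulrN.
by move=> gk; rewrite (ve _ _ gk) e1 mul1r.

Qed.

End Unique.

Lemma val_infty_unique v w : kvaluation phi v -> centered_at phi None v ->
  kvaluation phi w -> centered_at phi None w -> v = w.
Proof.
move=> vk vc wk wc; have [vv _ _] := vk; have [ww _ _] := wk.
apply: (valuation_ext vv ww) => u u0; have [l ul] := wt_ex M u0.
by rewrite !(val_infty_wt _ _ ul).
Qed.

End Infinity.

(** * Affine places *)

Section AffinePlace.
Variables (K : closedFieldType) (f : {poly K}) (d n : nat) (L : fieldType).
Local Notation A := {poly {poly K}}.
Variable phi : {rmorphism A -> L}.
Hypothesis S : smooth_model f d n phi.
Let M := smooth_model_model S.
Variable P : K * K.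
Hypothesis onP : P.2 ^+ d = f.[P.1].
Local Notation ev := (at_point P).

(** The kernel is generated by y^d - f, which vanishes at P, so the value at P depends on the
    function only. *)
Lemma at_point_eq u w : phi u = phi w -> ev u = ev w.
Proof.
move=> E; apply/eqP; rewrite -subr_eq0 -at_pointB; apply/eqP.
have {E} : phi (u - w) = 0 by rewrite rmorphB E subrr.
move: (u - w) => {u w} u /(model_ker M)[q ->].
rewrite at_pointM at_pointB at_pointXn at_pointX at_pointC onP.
by rewrite subrr mulr0.
Qed.

(** At a branch point (a, 0) the root a of f is simple, and x - a is a unit times y^d. Elsewhere x -
    a is a parameter because d b^(d-1) is nonzero. *)
Definition uniformizer : A := if P.2 == 0 then 'X else ('X - P.1%:P)%:P.

Lemma at_unif : ev uniformizer = 0.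
Proof.
rewrite /uniformizer; case: (P.2 =P 0) => [p2|_]; first by rewrite at_pointX.
by rewrite at_pointC !hornerE subrr.
Qed.

Lemma phi_unif : phi uniformizer != 0.
Proof.
rewrite /uniformizer; case: (P.2 =P 0) => _; first exact: (phiX_neq0 S).
by rewrite (phiC_eq0 S) polyXsubC_eq0.
Qed.

Lemma ev_decomp u : ev u = 0 ->
  exists B C : A, u = B * ('X - P.2%:P%:P) + C * ('X - P.1%:P)%:P.
Proof.
move=> u0.
have /factor_theorem[B BE] : root (u - u.[P.2%:P]%:P) P.2%:P.
  by rewrite /root !hornerE subrr.
have /factor_theorem[C CE] : root u.[P.2%:P] P.1 by rewrite /root; apply/eqP.
exists B, C%:P; rewrite -BE -polyCM -CE subrK //.
Qed.

Lemma f_decomp : exists f1, f - (f.[P.1])%:P = f1 * ('X - P.1%:P).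
Proof. by apply/factor_theorem; rewrite /root !hornerE subrr. Qed.

Lemma branch_decomp : P.2 = 0 -> exists2 f1, f = f1 * ('X - P.1%:P) & f1.[P.1] != 0.
Proof.
move=> p2; have [f1 fE] := f_decomp.
have {}fE : f = f1 * ('X - P.1%:P).
  rewrite -fE -onP p2 expr0n (_ : (d == 0%N) = false) ?subr0 //.
  by have := model_d_gt0 M; case: (d).
exists f1 => //; apply/negP => r1; have /factor_theorem[f2 f1E] : root f1 P.1 by [].
by have := smooth_model_sqfree S P.1; rewrite fE f1E -mulrA -expr2 dvdp_mulIr.
Qed.

Lemma mulrn_power_neq0 (b : K) : b != 0 -> b ^+ d.-1 *+ d != 0.
Proof.
by move=> b0; rewrite -mulr_natr mulf_neq0 ?expf_neq0 //; exact: (smooth_model_char S).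
Qed.

(** The maximal ideal (x - a, y - b) of the local ring is principal, stated without fractions: s is
    a unit at P. At a branch point f1 (x - a) = y^d with f1(a) nonzero. Elsewhere y^d - b^d = f -
    f(a) reads s (y - b) = f1 (x - a), and s takes the value d b^(d-1) at P. *)
Lemma local_param u : ev u = 0 ->
  exists s u1, ev s != 0 /\ phi (s * u) = phi (uniformizer * u1).
Proof.
move=> /ev_decomp[B [C ->]]; rewrite /uniformizer; case: (P.2 =P 0) => [p2|/eqP p2].
  have [f1 fE f10] := branch_decomp p2.
  have E : phi (f1%:P * ('X - P.1%:P)%:P) = phi ('X * 'X^(d.-1)).
    by rewrite -polyCM -fE -exprS prednK ?(model_d_gt0 M) // rmorphXn (phiXd S).
  exists f1%:P, (C * 'X^(d.-1) + f1%:P * B); rewrite at_pointC; split=> //.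
  have -> : f1%:P * (B * ('X - P.2%:P%:P) + C * ('X - P.1%:P)%:P) =
      f1%:P * B * 'X + C * (f1%:P * ('X - P.1%:P)%:P) by rewrite p2 !polyC0 subr0; ring.
  by rewrite rmorphD [phi (C * _)]rmorphM E -rmorphM -rmorphD; congr (phi _); ring.
have [f1 fE] := f_decomp.
pose s := \sum_(i < d) ('X : A) ^+ (d.-1 - i) * (P.2%:P%:P) ^+ i.
have sE : ('X - P.2%:P%:P) * s = 'X^d - (P.2 ^+ d)%:P%:P.
  by rewrite /s !rmorphXn -subrXX.
exists s, (B * f1%:P + C * s); split.
  rewrite /s /at_point horner_sum horner_sum (eq_bigr (fun=> P.2 ^+ d.-1)); last first.
    move=> i _; rewrite !hornerE -exprD subnK //.
    by have := ltn_ord i; lia.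
  by rewrite sumr_const card_ord mulrn_power_neq0.
have sE' : phi (s * ('X - P.2%:P%:P)) = phi (('X - P.1%:P)%:P * f1%:P).
  rewrite mulrC sE -polyCM [X in _ = phi X%:P]mulrC -fE -onP.
  by rewrite polyCB !rmorphB rmorphXn (phiXd S).
have -> : s * (B * ('X - P.2%:P%:P) + C * ('X - P.1%:P)%:P) =
   B * (s * ('X - P.2%:P%:P)) + ('X - P.1%:P)%:P * (C * s) by ring.
by rewrite rmorphD rmorphM sE' -rmorphM -rmorphD; congr (phi _); ring.
Qed.

Definition ramification : nat := if P.2 == 0 then d else 1.

Lemma ramif_unif : exists s,
  ev s != 0 /\ phi (s * ('X - P.1%:P)%:P) = phi (uniformizer ^+ ramification).
Proof.
rewrite /uniformizer /ramification; case: (P.2 =P 0) => [p2|/eqP p2]; last first.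
  by exists 1; rewrite mul1r expr1 at_pointC hornerC oner_neq0.
have [f1 fE f10] := branch_decomp p2; exists f1%:P; rewrite at_pointC; split=> //.
by rewrite -polyCM -fE rmorphXn (phiXd S).
Qed.

(* u = uniformizer ^ k * unit in the local ring at P. *)
Definition lorder (u : A) (k : nat) : Prop :=
  exists s s', [/\ ev s != 0, ev s' != 0 & phi (s * u) = phi (uniformizer ^+ k * s')].

Lemma lorderM u w k l : lorder u k -> lorder w l -> lorder (u * w) (k + l).
Proof.
move=> [s [s' [s0 s'0 E]]] [t [t' [t0 t'0 E']]].
exists (s * t), (s' * t'); rewrite !at_pointM !mulf_neq0 //; split=> //.
rewrite mulrACA [in LHS]rmorphM E E' -rmorphM; congr (phi _); rewrite exprD; ring.
Qed.

Lemma lorder_unit u : ev u != 0 -> lorder u 0.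
Proof.
by move=> u0; exists 1, u; rewrite at_pointC hornerC oner_neq0 expr0.
Qed.

Lemma lorder_unif : lorder uniformizer 1.
Proof.
by exists 1, 1; rewrite at_pointC hornerC oner_neq0 mul1r mulr1 expr1.
Qed.

Lemma lorderX u k m : lorder u k -> lorder (u ^+ m) (k * m).
Proof.
move=> uk; elim: m => [|m IH]; last by rewrite exprS mulnS; apply: lorderM.
by rewrite muln0 expr0; apply: lorder_unit; rewrite at_pointC hornerC oner_neq0.
Qed.

Lemma lorderC (q : {poly K}) : q != 0 -> exists k, lorder q%:P k.
Proof.
move=> q0; have [m [q1 + qE]] := multiplicity_XsubC q P.1.
rewrite q0 /= => q10; exists (0 + ramification * m)%N.
rewrite qE polyCM; apply: lorderM; first by apply: lorder_unit; rewrite at_pointC.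
rewrite rmorphXn; apply: lorderX.
have [s [s0 sE]] := ramif_unif; exists s, 1; rewrite s0 at_pointC hornerC oner_neq0.
by rewrite mulr1.
Qed.

(** Cancelling the k-th power of the uniformizer leaves a unit at P equal to a multiple of the
    uniformizer; evaluation at P refutes this. *)
Lemma lorder_lt u k w : lorder u k -> (exists2 s,
  ev s != 0 & phi (s * u) = phi (uniformizer ^+ k.+1 * w)) -> False.
Proof.
move=> [s [s' [s0 s'0 E]]] [t t0 E'].
have : phi (t * (s * u)) = phi (uniformizer ^+ k * (uniformizer * (s * w))).
  rewrite mulrCA [in LHS]rmorphM E' -rmorphM; congr (phi _); rewrite exprS; ring.
rewrite rmorphM E -rmorphM mulrCA !(rmorphM phi (uniformizer ^+ k)).
have uk0 : phi (uniformizer ^+ k) != 0 by rewrite rmorphXn expf_neq0 ?phi_unif.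
move=> /(mulfI uk0)/at_point_eq/eqP; rewrite !at_pointM at_unif mul0r mulf_eq0.
by rewrite (negPf t0) (negPf s'0).
Qed.

Lemma lorder_unique u w k l : phi u = phi w -> lorder u k -> lorder w l -> k = l.
Proof.
wlog kl : u w k l / (k < l)%N => [H|] E uk wl.
  have [lt|lt|//] := ltngtP k l; first exact: (H u w).
  by apply/esym/(H w u).
have [s [s' [s0 s'0 sE]]] := wl;
  case: (@lorder_lt u k (uniformizer ^+ (l - k.+1) * s') uk).
exists s => //; rewrite rmorphM E -rmorphM sE; congr (phi _).
by rewrite mulrA -exprD subnKC.
Qed.

(* Dividing by the uniformizer stops because u divides a nonzero q(x). *)
Lemma lorder_ex u : phi u != 0 -> exists k, lorder u k.
Proof.
move=> u0; have [q q0 [u' qE]] := smooth_model_frac S (phi u)^-1.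
have {}qE : phi q%:P = phi (u' * u).
  by rewrite rmorphM -qE mulrAC mulVf // mul1r.
have [m qm] := lorderC q0.
have [ex|[s [w [s0 sE]]]] : (exists k, lorder u k) \/
    exists s w, ev s != 0 /\ phi (s * u) = phi (uniformizer ^+ m.+1 * w).
  elim: m.+1 => [|k [|[s [w [s0 sE]]]]]; last 2 first.
  - by left.
  - have [w0|w0] := eqVneq (ev w) 0; last by left; exists k, s, w.
    have [s' [w' [s'0 wE]]] := local_param w0; right; exists (s' * s), w'.
    rewrite at_pointM mulf_neq0 //; split=> //.
    rewrite -mulrA rmorphM sE -rmorphM mulrCA rmorphM wE -rmorphM.
    by congr (phi _); rewrite exprSr mulrA.
  by right; exists 1, u; rewrite at_pointC hornerC oner_neq0.
  exact: ex.
case: (@lorder_lt q%:P m (u' * w) qm); exists s => //.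
rewrite rmorphM qE -rmorphM mulrCA rmorphM sE -rmorphM; congr (phi _); ring.
Qed.

Lemma lorderD u w k l m : lorder u k -> lorder w l -> lorder (u + w) m ->
  (minn k l <= m)%N.
Proof.
move=> [s [s' [s0 s'0 sE]]] [t [t' [t0 t'0 tE]]] uwm.
rewrite leqNgt; apply/negP; rewrite ltn_min => /andP[mk ml].
case: (@lorder_lt (u + w) m (uniformizer ^+ (k - m.+1) * s' * t + uniformizer ^+ (l -
  m.+1) * t' * s) uwm).
exists (s * t); first by rewrite at_pointM mulf_neq0.
have -> : s * t * (u + w) = t * (s * u) + s * (t * w) by ring.
rewrite rmorphD !(rmorphM phi _ (_ * _)) sE tE -!rmorphM -rmorphD; congr (phi _).
rewrite -{1}(subnKC mk) -{1}(subnKC ml) !exprD; ring.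
Qed.

Lemma val_affine_exists : exists v, [/\ kvaluation phi v, centered_at phi (Some P) v &
  forall u k, lorder u k -> v (phi u) = k%:Z].
Proof.
pose R u (k : int) := exists2 l, lorder u l & k = l%:Z.
have [|u u0|u w k l E [i ui ->] [j wj ->]|u w k l [i ui ->] [j wj ->]|
   u w k l m [i ui ->] [j wj ->] [t ut ->]|v [vv vE]] :=
    @valuation_extension A L phi R.
- exact: (phi_frac S).
- by have [l ul] := lorder_ex u0; exists l%:Z, l.
- by rewrite (lorder_unique E ui wj).
- by exists (i + j)%N; [exact: lorderM | rewrite PoszD].
- have := lorderD ui wj ut; lia.
have vE' u k : lorder u k -> v (phi u) = k%:Z.
  move=> uk; have [u0|u0] := eqVneq (phi u) 0; last by apply: vE => //; exists k.
  have [s [s' [s0 s'0]]] := uk; rewrite rmorphM u0 mulr0 rmorphM => /esym/eqP.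
  rewrite mulf_eq0 rmorphXn expf_eq0 (negPf phi_unif) andbF /= => /eqP s'0'.
  by move: s'0; rewrite (@at_point_eq s' 0) ?rmorph0 // at_pointC hornerC eqxx.
have pos u : phi u != 0 -> ev u = 0 -> 0 < v (phi u).
  move=> u0 e0; have [[|k] uk] := lorder_ex u0; last by rewrite (vE' _ _ uk).
  have [s [s' [s0 s'0]]] := uk; rewrite expr0 mul1r => /at_point_eq/eqP.
  by rewrite at_pointM e0 mulr0 eq_sym (negPf s'0).
exists v; split=> //.
  split=> // [c|].
    have [->|c0] := eqVneq c 0; first by rewrite !polyC0 rmorph0; case: vv.
    by apply: (vE' _ 0%N); apply: lorder_unit; rewrite at_pointC hornerC.
  by exists (phi uniformizer); [exact: phi_unif | rewrite (vE' _ _ lorder_unif)].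
apply/centered_atE; split.
  by apply: pos; rewrite ?(phiC_eq0 S) ?polyXsubC_eq0 // at_pointC !hornerE subrr.
apply: pos; last by rewrite at_pointB at_pointX at_pointC hornerC subrr.
apply/negP => /eqP/(model_inj M); rewrite size_XsubC => /(_ (smooth_model_d_gt1 S)).
by move/eqP; rewrite polyXsubC_eq0.
Qed.

Section Unique.
Variable v : L -> int.
Hypotheses (vk : kvaluation phi v) (vc : centered_at phi (Some P) v).
Let vv : valuation v. Proof. by case: vk. Qed.

Lemma val_constant c : vge v 0 (phi c%:P%:P).
Proof. by case: vk => _ vC _; rewrite /vge vC lexx orbT. Qed.

Lemma val_affine_ge0 u : vge v 0 (phi u).
Proof.
have [vx0 vy0] := (centered_atE phi P v).1 vc.
have vx : vge v 0 (phi 'X%:P).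
  have -> : 'X%:P = ('X - P.1%:P)%:P + P.1%:P%:P :> A by rewrite polyCB subrK.
  by rewrite rmorphD vgeD ?val_constant // /vge ltW ?orbT.
have vy : vge v 0 (phi 'X).
  have -> : 'X = ('X - P.2%:P%:P) + P.2%:P%:P :> A by rewrite subrK.
  by rewrite rmorphD vgeD ?val_constant // /vge ltW ?orbT.
rewrite -[u]coefK poly_def rmorph_sum; apply: vge_sum => // j _.
rewrite -mul_polyC rmorphM -[0]addr0 vgeM // ?rmorphXn ?vgeX //.
rewrite -[u`_j]coefK poly_def rmorph_sum rmorph_sum; apply: vge_sum => // i _.
rewrite -mul_polyC rmorphM rmorphM -[0]addr0 vgeM //; first exact: val_constant.
by rewrite rmorphXn rmorphXn vgeX.
Qed.

Lemma val_affine_pos u : ev u = 0 -> vge v 1 (phi u).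
Proof.
move=> /ev_decomp[B [C ->]]; rewrite rmorphD !rmorphM.
have [vx vy] := (centered_atE phi P v).1 vc.
by apply: vgeD => //; rewrite -[1]add0r; apply: vgeM; rewrite ?val_affine_ge0 //;
  rewrite /vge -gtz0_ge1 ?vx ?vy orbT.
Qed.

Lemma val_affine_unit u : ev u != 0 -> v (phi u) = 0.
Proof.
move=> u0; have [_ vC _] := vk.
have c0 : phi (ev u)%:P%:P != 0 by rewrite (phiC_eq0 S) polyC_eq0.
rewrite -[u](subrK (ev u)%:P%:P) addrC rmorphD.
have [|_ ->] := val_dom vv c0 (h := phi (u - (ev u)%:P%:P)); last exact: vC.
by rewrite vC add0r val_affine_pos // at_pointB at_pointC hornerC subrr.
Qed.

Lemma lorder_neq0 u k : lorder u k -> phi u != 0.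
Proof.
move=> [s [s' [s0 s'0 E]]]; apply: contraTneq s'0 => u0; rewrite negbK.
have /eqP : phi s' = phi 0.
  apply: (mulfI (expf_neq0 k phi_unif)); rewrite -rmorphXn -!rmorphM -E mulr0.
  by rewrite rmorphM u0 mulr0 rmorph0.
by move=> /eqP/at_point_eq->; rewrite at_pointC hornerC.
Qed.

(** Units at P have valuation 0, so only the power of the uniformizer counts. *)
Lemma val_affine_scale u k : lorder u k -> v (phi u) = v (phi uniformizer) * k%:Z.
Proof.
move=> uk; have u0 := lorder_neq0 uk; move: uk => [s [s' [s0 s'0 /(congr1 v)]]].
have nz w : ev w != 0 -> phi w != 0.
  by move=> w0; apply: (@lorder_neq0 _ 0); exact: lorder_unit.
rewrite !rmorphM rmorphXn !(valuationM vv) ?(nz _ s0) ?(nz _ s'0) ?u0 ?expf_neq0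
  ?phi_unif //.
by rewrite (val_affine_unit s0) (val_affine_unit s'0) add0r addr0 (valuationX vv)
  ?phi_unif.
Qed.

Lemma val_unif_gt0 : 0 < v (phi uniformizer).
Proof.
have := val_affine_pos at_unif; rewrite vgeE ?phi_unif //; exact: lt_le_trans.
Qed.

Lemma val_affine_lorder u k : lorder u k -> v (phi u) = k%:Z.
Proof.
have [w [[ww _ _] wc wE]] := val_affine_exists; have [_ _ vn] := vk.
have e1 : v (phi uniformizer) = 1.
  apply: (normalized_proportional vn (ltW val_unif_gt0)).
  apply: (proportional_ext S vv ww) => u' u'0; have [l ul] := lorder_ex u'0.
  by rewrite (val_affine_scale ul) (wE _ _ ul).
by move=> uk; rewrite (val_affine_scale uk) e1 mul1r.
Qed.

Lemma val_affine_x : v (phi ('X - P.1%:P)%:P) = ramification%:Z.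
Proof.
apply: val_affine_lorder; have [s [s0 sE]] := ramif_unif.
by exists s, 1; rewrite s0 at_pointC hornerC oner_neq0 mulr1.
Qed.

End Unique.

Lemma val_affine_unique v w : kvaluation phi v -> centered_at phi (Some P) v ->
  kvaluation phi w -> centered_at phi (Some P) w -> v = w.
Proof.
move=> vk vc wk wc; have [vv _ _] := vk; have [ww _ _] := wk.
apply: (valuation_ext S vv ww) => u u0; have [l ul] := lorder_ex u0.
by rewrite (val_affine_lorder vk vc ul) (val_affine_lorder wk wc ul).
Qed.
End AffinePlace.

(** * Regular functions and torsion points *)

(** One root is multiplied by the d-th roots of unity, which are distinct because d is invertible in
    K. *)
Lemma power_roots (K : closedFieldType) (d : nat) (c : K) :
    d%:R != 0 :> K -> c != 0 ->
  exists rs : seq K, [/\ uniq rs, size rs = d & forall r, r \in rs -> r ^+ d = c].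
Proof.
move=> d0 c0; have d_gt0 : (0 < d)%N by case: d d0; rewrite ?eqxx.
have [r0 /eqP] : exists r0, root ('X^d - c%:P) r0.
  by apply/closed_rootP; rewrite size_XnsubC //; case: d d_gt0 {d0}.
rewrite !hornerE => /eqP; rewrite subr_eq0 => /eqP r0d.
have r00 : r0 != 0 by apply: contraNneq c0 => r00; rewrite -r0d r00 expr0n gtn_eqF.
have [rs E] := closed_field_poly_normal ('X^d - 1 : {poly K}).
have mon : ('X^d - 1 : {poly K}) \is monic by rewrite -polyC1 monicXnsubC.
rewrite (monicP mon) scale1r in E.
have us : uniq rs by rewrite -separable_prod_XsubC -E separable_Xn_sub_1.
exists [seq r0 * r | r <- rs]; split.
- by rewrite map_inj_uniq // => x y /(mulfI r00).
- by rewrite size_map; apply/eq_add_S;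
  rewrite -(size_prod_XsubC rs id) -E -polyC1 size_XnsubC.
move=> _ /mapP[r rrs ->]; have : root ('X^d - 1) r by rewrite E root_prod_XsubC.
by rewrite /root !hornerE subr_eq0 exprMn => /eqP->; rewrite mulr1.
Qed.

Lemma other_root (K : closedFieldType) (d : nat) (b : K) :
  (1 < d)%N -> d%:R != 0 :> K -> b != 0 -> exists2 b', b' != b & b' ^+ d = b ^+ d.
Proof.
move=> d1 d0 b0; have [rs [us sz rsE]] := power_roots d0 (expf_neq0 d b0).
case: rs us sz rsE => [|r [|s rs]] /=; try by move=> *; lia.
rewrite inE negb_or => /andP[/andP[rs0 _] _] _ H.
have [rb|rb] := eqVneq r b; last by exists r => //; rewrite H ?mem_head.
by exists s; [rewrite -rb eq_sym | rewrite H // inE mem_head orbT].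
Qed.

Section Order.
Variables (K : closedFieldType) (f : {poly K}) (d n : nat) (L : fieldType).
Local Notation A := {poly {poly K}}.
Variable phi : {rmorphism A -> L}.
Hypothesis S : smooth_model f d n phi.
Let M := smooth_model_model S.
Let d_gt0 := model_d_gt0 M.

(** The choice made by [ord], repeated over the abstract field; uniqueness of places identifies the
    two in [ordE]. *)
Definition aord (P : point f d) : L -> int :=
  xget (fun=> 0) [set v | kvaluation phi v /\ centered_at phi (val P) v]%classic.

Lemma on_affine (P : point f d) p : val P = Some p -> p.2 ^+ d = f.[p.1].
Proof. by move=> E; have := valP P; rewrite E; case: p {E} => a b /= /eqP. Qed.

Lemma aord_spec P : kvaluation phi (aord P) /\ centered_at phi (val P) (aord P).
Proof.
rewrite /aord; case: xgetP => [v _ //|H].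
case E : (val P) => [p|]; last first.
  by have [v [vk vc _]] := val_infty_exists S; case: (H v); rewrite E.
by have [v [vk vc _]] := val_affine_exists S (on_affine E); case: (H v); rewrite E.
Qed.

Lemma aord_valuation P : valuation (aord P).
Proof. by have [[]] := aord_spec P. Qed.

Lemma aord_unique P v : kvaluation phi v -> centered_at phi (val P) v -> aord P = v.
Proof.
have [wk wc] := aord_spec P; move: wc; case E : (val P) => [p|] wc vk vc.
  exact: (val_affine_unique S (on_affine E)).
exact: (val_infty_unique S).
Qed.

Lemma aord_infty g k : wt d n phi g k -> aord infty g = - k%:Z.
Proof. by have [wk wc] := aord_spec infty; exact: (val_infty_wt S wk wc). Qed.

Section Affine.
Variables (P : point f d) (p : K * K).
Hypothesis PE : val P = Some p.

Lemma aord_center : centered_at phi (Some p) (aord P).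
Proof. by have [_] := aord_spec P; rewrite PE. Qed.

Lemma aord_ge0 u : vge (aord P) 0 (phi u).
Proof. exact: val_affine_ge0 (aord_spec P).1 aord_center _. Qed.

Lemma aord_unit u : at_point p u != 0 -> aord P (phi u) = 0.
Proof. exact: (val_affine_unit S (aord_spec P).1 aord_center). Qed.

Lemma aord_pos u : at_point p u = 0 -> vge (aord P) 1 (phi u).
Proof. exact: (val_affine_pos (aord_spec P).1 aord_center). Qed.

Lemma aord_x : aord P (phi ('X - p.1%:P)%:P) = (ramification d p)%:Z.
Proof. exact: (val_affine_x S (on_affine PE) (aord_spec P).1 aord_center). Qed.

Lemma aord_y : p.2 = 0 -> aord P (phi 'X) = 1.
Proof.
move=> p2; have := val_affine_lorder S (on_affine PE) (aord_spec P).1 aord_center.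
by move=> /(_ _ _ (lorder_unif _ _)); rewrite /uniformizer p2 eqxx.
Qed.

Lemma aord_gt0_at u : 0 < aord P (phi u) -> at_point p u = 0.
Proof.
by move=> u0; apply/eqP; apply: contraTT u0 => /aord_unit ->; rewrite ltxx.
Qed.

End Affine.

Lemma vgeM_cancel (v : L -> int) g h k : valuation v -> g != 0 ->
  vge v (v g + k) (g * h) -> vge v k h.
Proof.
move=> vv g0; have [->|h0] := eqVneq h 0; first by rewrite vge0.
by rewrite !vgeE ?mulf_neq0 // (valuationM vv) // lerD2l.
Qed.

Definition apoint a b (H : b ^+ d == f.[a]) : point f d := @Point K f d (Some (a, b)) H.

(** At (a, 0) the function y has order 1, and a polynomial in x vanishing at a has order at least d.
    So the constant term in y vanishes at a, hence has order at least m, and the rest can be divided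
    by y, lowering m by one. *)
Lemma coefs_vanish_branch (P : point f d) a (u : A) m :
  val P = Some (a, 0) -> (size u <= m)%N -> (m <= d)%N -> vge (aord P) m%:Z (phi u) ->
  forall j, root u`_j a.
Proof.
move=> PE; have vv := aord_valuation P; elim/poly_ind: u m => [|u c IH] m.
  by move=> *; rewrite coef0 root0.
rewrite size_MXaddC; case: ifP => [/andP[/eqP-> /eqP->] _ _ _ j|_].
  by rewrite mul0r add0r coef0 root0.
case: m => // m; rewrite ltnS => su md um.
have c0 : root c a.
  rewrite /root; apply/eqP.
  have : at_point (a, 0) (u * 'X + c%:P) = 0.
    apply/eqP; apply: contraT => nz; have := um.
    rewrite /vge (aord_unit PE nz) orbF => /eqP E.
    move: nz; rewrite (@at_point_eq _ _ _ _ _ _ S _ (on_affine PE) _ 0) ?rmorph0 //.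
    by rewrite at_pointC hornerC eqxx.
  by rewrite at_pointD at_pointM at_pointX mulr0 add0r at_pointC.
have cv : vge (aord P) m.+1%:Z (phi c%:P).
  have /factor_theorem[c1 ->] := c0; apply: (@vgeW _ _ d%:Z); first by rewrite lez_nat.
  rewrite polyCM rmorphM -[d%:Z]add0r vgeM ?(aord_ge0 PE) // /vge.
  by rewrite (aord_x PE) /ramification eqxx lexx orbT.
have uv : vge (aord P) m%:Z (phi u).
  apply: (vgeM_cancel (g := phi 'X) vv); first exact: (phiX_neq0 S).
  rewrite (aord_y PE) // -intS -rmorphM mulrC.
  by rewrite -[u * 'X](addrK c%:P) rmorphB vgeB.
move=> j; rewrite coefD coefMX coefC; case: j => [|j]; first by rewrite add0r.
by rewrite addr0; apply: (IH m su (ltnW md) uv).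
Qed.

Lemma at_point_map a b (u : A) : at_point (a, b) u = (map_poly (horner_eval a) u).[b].
Proof.
by rewrite /at_point /= -[b in RHS](hornerC b a) -/(horner_eval a b%:P) horner_map.
Qed.

(** The hypothesis says that u / (x - a) is regular above a. If f(a) = 0, the single point above a
    is a branch point. Otherwise u(a, y), of degree below d, has d distinct roots. *)
Lemma coefs_vanish a (u : A) : (size u <= d)%N ->
  (forall (P : point f d) b, val P = Some (a, b) -> vge (aord P) (ramification d (a,
    b))%:Z (phi u)) ->
  forall j, root u`_j a.
Proof.
move=> su H; have [fa|fa] := eqVneq f.[a] 0.
  have on0 : 0 ^+ d == f.[a] by rewrite fa expr0n gtn_eqF.
  move=> j; apply: (@coefs_vanish_branch (apoint on0) _ _ d) => //.
  by have := H (apoint on0) 0 erefl; rewrite /ramification eqxx.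
have [rs [us sz rsE]] := power_roots (smooth_model_char S) fa.
have p0 : map_poly (horner_eval a) u = 0.
  apply/eqP; apply: contraLR su => p0; rewrite -ltnNge -sz.
  have le_u : (size (map_poly (horner_eval a) u) <= size u)%N by exact: size_poly.
  apply: leq_trans le_u; apply: (max_poly_roots p0 _ us).
  apply/seq.allP => b /rsE bd; rewrite /root -at_point_map.
  have on : b ^+ d == f.[a] by rewrite bd.
  have b0 : b != 0 by apply: contraNneq fa => b0; rewrite -bd b0 expr0n gtn_eqF.
  have := H (apoint on) b erefl; rewrite /ramification (negPf b0).
  apply: contraTT => nz.
  have PE : val (apoint on) = Some (a, b) by [].
  rewrite /vge (aord_unit PE nz) orbF; apply: contraNN nz => /eqP E.
  rewrite (@at_point_eq _ _ _ _ _ _ S _ (on_affine PE) _ 0) ?rmorph0 //.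
  by rewrite at_pointC hornerC.
move=> j; have := congr1 (fun q : {poly K} => q`_j) p0.
by rewrite coef_map_id0 ?rmorph0 // coef0 /root => /eqP.
Qed.

(* Take a denominator q(x) of g of least degree: at a root a of q, regularity at all
   the points above a forces x - a to divide the numerator as well. *)
Lemma poly_of_regular g :
  (forall P : point f d, P != infty -> vge (aord P) 0 g) ->
  exists2 u : A, (size u <= d)%N & g = phi u.
Proof.
move=> reg; have [q q0 [u0 E0]] := smooth_model_frac S g.
have [k ku] := wlt_ex d n u0; have [u [su _ uE _]] := wlt_reduce M ku.
rewrite -uE in E0; move: q0 su E0 {u0 uE k ku}.
have [s] := ubnP (size q); elim: s q u => // s IH q u; rewrite ltnS => sq q0 su E.
have [/eqP/size_poly1P[c c0 qE]|/closed_rootP[a ra]] := eqVneq (size q) 1%N.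
  exists (c^-1%:P%:P * u); first by rewrite mul_polyC size_scale // polyC_eq0 invr_eq0.
  have C0 : phi c%:P%:P != 0 by rewrite (phiC_eq0 S) polyC_eq0.
  have gE : g * phi c%:P%:P = phi u by rewrite -qE.
  apply: (mulIf C0); rewrite gE rmorphM mulrAC -rmorphM -!polyCM mulVf //.
  by rewrite !polyC1 rmorph1 mul1r.
have /factor_theorem[q1 qE] := ra.
have q10 : q1 != 0 by apply: contraNneq q0 => q10; rewrite qE q10 mul0r.
have van : forall j, root u`_j a.
  apply: coefs_vanish => // P b PE; rewrite -E qE polyCM rmorphM -[_%:Z]add0r.
  have vv := aord_valuation P; apply: vgeM => //.
    by apply: reg; apply/eqP => Pi; move: PE; rewrite Pi.
  rewrite -[_%:Z]add0r; apply: vgeM => //; first exact: (aord_ge0 PE).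
  by rewrite /vge (aord_x PE) lexx orbT.
pose w : A := \poly_(j < size u) (u`_j %/ ('X - a%:P)).
have uw : u = w * ('X - a%:P)%:P.
  apply/polyP => j; rewrite coefMC coef_poly; case: ltnP => sj.
    by rewrite divpK // dvdp_XsubCl.
  by rewrite mul0r nth_default.
apply: (IH q1 w _ q10) => //.
- have := sq; rewrite qE size_Mmonic ?monicXsubC // size_XsubC addn2 /=.
  exact.
- by apply: leq_trans su; exact: size_poly.
have X0 : phi ('X - a%:P)%:P != 0 by rewrite (phiC_eq0 S) polyXsubC_eq0.
by apply: (mulIf X0); rewrite -mulrA -!rmorphM -qE -uw.
Qed.

(** Reduced representatives are unique and reduction does not raise weights, so a bound on the pole
    at O bounds the coefficients of u itself. *)
Lemma reduced_wlt (u : A) k : (size u <= d)%N -> wt d n phi (phi u) k -> wlt d n k.+1 u.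
Proof.
move=> su /wt_wlt[w kw E]; have [r [sr kr rE _]] := wlt_reduce M kw.
suff -> : u = r by [].
apply/eqP; rewrite -subr_eq0; apply/eqP/(model_inj M).
  by rewrite (leq_trans (size_polyD _ _)) // size_polyN geq_max su sr.
by rewrite rmorphB rE E subrr.
Qed.

End Order.

Lemma all_roots_eq (K : closedFieldType) (p : {poly K}) a :
  p != 0 -> (forall x, root p x -> x = a) ->
  p = lead_coef p *: ('X - a%:P) ^+ (size p).-1.
Proof.
move=> p0 H; have [rs E] := closed_field_poly_normal p.
have l0 : lead_coef p != 0 by rewrite lead_coef_eq0.
have -> : (size p).-1 = size rs by rewrite E size_scale // (size_prod_XsubC rs id).
rewrite [LHS]E; congr (_ *: _).
have {}H : forall x, x \in rs -> x = a.
  by move=> x xrs; apply: H; rewrite E rootZ // root_prod_XsubC.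
elim: rs H {E} => [|x rs IH] H; first by rewrite big_nil expr0.
rewrite big_cons exprS (H x) ?mem_head // IH // => y yrs.
by apply: H; rewrite inE yrs orbT.
Qed.

(** * Principal multiples of (P) - (O) *)

Section Kills.
Variables (K : closedFieldType) (f : {poly K}) (d n : nat) (L : fieldType).
Local Notation A := {poly {poly K}}.
Variable phi : {rmorphism A -> L}.
Hypothesis S : smooth_model f d n phi.
Let M := smooth_model_model S.
Let d_gt0 := model_d_gt0 M.
Let d_gt1 := smooth_model_d_gt1 S.
Local Notation aord := (@aord K f d L phi).

(* The divisor k (P) - k (O) is principal. *)
Definition kills (P : point f d) (k : nat) : Prop :=
  exists2 g : L, g != 0 &
    forall Q, aord Q g = (Q == P)%:Z * k%:Z - (Q == infty)%:Z * k%:Z.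

Definition aorder (P : point f d) (m : nat) : Prop :=
  [/\ (0 < m)%N, kills P m & forall k, (0 < k < m)%N -> ~ kills P k].

Lemma kills_modn P k l : kills P k -> kills P l -> kills P (k %% l).
Proof.
move=> [g g0 gE] [h h0 hE]; exists (g / h ^+ (k %/ l)).
  by rewrite mulf_neq0 ?invr_neq0 ?expf_neq0.
move=> Q; have vv := aord_valuation S Q.
rewrite valuationM ?invr_neq0 ?expf_neq0 // valuationV // valuationX // gE hE.
have -> : (k %% l)%:Z = k%:Z - (k %/ l)%:Z * l%:Z.
  by rewrite {2}(divn_eq k l) PoszD PoszM addrC addKr.
by ring.
Qed.

Section Affine.
Variables (P : point f d) (p : K * K).
Hypothesis PE : val P = Some p.

Let P_infty : (P == infty) = false.
Proof. by apply/eqP => Pi; move: PE; rewrite Pi. Qed.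

Lemma point_inj (Q : point f d) : val Q = Some p -> Q = P.
Proof. by move=> QE; apply: val_inj; rewrite QE -PE. Qed.

(** The order at P is supplied as a hypothesis rather than deduced from the degree of a principal
    divisor. *)
Lemma killsI (u : A) k : wt d n phi (phi u) k ->
  (forall q, q.2 ^+ d = f.[q.1] -> at_point q u = 0 -> q = p) ->
  aord P (phi u) = k%:Z -> kills P k.
Proof.
move=> uk uz uP; exists (phi u); first exact: (wt_neq0 M uk).
move=> Q; have [->|QP] := eqVneq Q P; first by rewrite P_infty uP mul1r mul0r subr0.
have [->|Qi] := eqVneq Q infty.
  by rewrite (aord_infty S uk) mul1r mul0r sub0r.
rewrite !mul0r subr0; case QE : (val Q) => [q|]; last first.
  by case/eqP: Qi; apply: val_inj.
apply: (aord_unit S QE); apply/negP => /eqP/(uz q (on_affine QE)) qp.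
by case/eqP: QP; apply: point_inj; rewrite QE qp.
Qed.

Lemma killsE k : kills P k -> exists u : A, [/\ (size u <= d)%N, wlt d n k.+1 u,
   wt d n phi (phi u) k, (0 < k)%N -> at_point p u = 0 &
   forall q, q.2 ^+ d = f.[q.1] -> at_point q u = 0 -> q = p].
Proof.
move=> [g g0 gE]; have [Q Qi|u su gu] := poly_of_regular S (g := g).
  by rewrite /vge gE (negPf Qi) mul0r subr0 mulr_ge0 ?orbT.
rewrite gu in g0 gE; have [l ul] := wt_ex M g0.
have lk : l = k.
  have := gE infty; rewrite (aord_infty S ul) eqxx eq_sym P_infty.
  by rewrite mul0r mul1r sub0r => /oppr_inj [].
rewrite lk in ul; exists u; split=> //; first exact: (reduced_wlt S su ul).
  move=> k0; apply: (aord_gt0_at S PE); rewrite gE eqxx P_infty.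
  by rewrite mul1r mul0r subr0 ltz_nat.
move=> q qon q0; have on : q.2 ^+ d == f.[q.1] by apply/eqP.
have QE : val (apoint on) = Some q by rewrite /= -surjective_pairing.
have := aord_pos S QE q0; rewrite vgeE // gE.
have [QP _|_] := eqVneq (apoint on) P.
  by move: QE; rewrite QP PE => -[].
by rewrite (_ : (apoint on == infty) = false) //; apply/eqP => Qi; move: QE; rewrite Qi.
Qed.

(** A polynomial c(x) of positive weight has a root r and vanishes at every (r, b) on the curve. If
    b were nonzero, another d-th root of f(r) would give a second zero. *)
Lemma branch_of_constant (c : {poly K}) k : (0 < k)%N -> wt d n phi (phi c%:P) k ->
    (forall q, q.2 ^+ d = f.[q.1] -> at_point q c%:P = 0 -> q = p) -> p.2 = 0.
Proof.
move=> k0 ck cz; have [r rc] : exists r, root c r.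
  apply/closed_rootP; apply/negP => /size_poly1P[c0 c00 cE].
  have /(wt_nwlt M) : wt d n phi (phi c%:P) k by [].
  apply; rewrite cE => i j; rewrite coefC; case: ifP => [/eqP->|_]; last
    by rewrite coef0 eqxx.
  by rewrite coefC; case: ifP => [/eqP->|_]; rewrite ?eqxx // !muln0.
have [b fb] : exists b, b ^+ d = f.[r].
  have [fr|fr] := eqVneq f.[r] 0; first by exists 0; rewrite fr expr0n gtn_eqF.
  have [[|b rs] [_ /= sz rsE]] := power_roots (smooth_model_char S) fr.
    by move: d_gt0; rewrite -sz.
  by exists b; apply: rsE; rewrite mem_head.
have at0 b' : at_point (r, b') c%:P = 0 by rewrite at_pointC; exact/eqP.
have pE := cz (r, b) fb (at0 b); apply/eqP; apply: contraT; rewrite -pE /= => b0.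
have [b' b'b b'E] := other_root d_gt1 (smooth_model_char S) b0.
have := cz (r, b') (etrans b'E fb) (at0 b'); rewrite -pE => -[/eqP].
by rewrite (negPf b'b).
Qed.

(* A function with poles of order < n at infinity only is a polynomial in x. *)
Lemma kills_small k : (0 < k < n)%N -> kills P k -> p.2 = 0 /\ (d <= k)%N.
Proof.
move=> /andP[k0 kn] /killsE[u [su ku uk _ uz]].
have uC : u = (u`_0)%:P.
  apply/polyP => -[|j]; rewrite coefC //=; apply/polyP => i; rewrite coef0.
  apply/eqP; apply: contraT => /ku; rewrite mulnS ltnS => H; exfalso.
  have := leq_trans _ H; move: kn; lia.
rewrite uC in ku uk uz; split; first exact: branch_of_constant uk uz.
rewrite leqNgt; apply/negP => kd; apply: (wt_nwlt M uk) => i j cij.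
have := ku i j cij; case: i cij => [|i] cij; last by rewrite mulnS; lia.
case: j cij => [|j]; first by rewrite !muln0.
by rewrite coefC coef0 eqxx.
Qed.

(** The divisor of x - a is d (P) - d (O), as (a, 0) is the only point above a. *)
Lemma kills_branch : p.2 = 0 -> kills P d.
Proof.
move=> p2; apply: (@killsI ('X - p.1%:P)%:P).
- exists 1, 1%N, 0%N, (- p.1%:P%:P); split; rewrite ?oner_neq0 ?muln1 ?muln0 ?addn0 //.
    apply: wltN => i j; rewrite coefC; case: ifP => [/eqP->|_]; last
      by rewrite coef0 eqxx.
    by rewrite coefC; case: ifP => [/eqP->|_]; rewrite ?eqxx // !muln0.
  by rewrite /mono scale1r expr1 expr0 mulr1 polyCB.
- move=> [a b] /= on; rewrite at_pointC !hornerE /= => /eqP; rewrite subr_eq0 => /eqP aE.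
  move: on; rewrite aE -(on_affine PE) p2 expr0n gtn_eqF // => /eqP.
  by rewrite expf_eq0 d_gt0 /= => /eqP->; rewrite -p2 -surjective_pairing.
by rewrite (aord_x S PE) /ramification p2 eqxx.
Qed.

Lemma aorder_branch : (d < n)%N -> p.2 = 0 -> aorder P d.
Proof.
move=> dn p2; split=> //; first exact: kills_branch.
move=> k /andP[k0 kd] /kills_small[|_]; first by rewrite k0 (ltn_trans kd).
by rewrite leqNgt kd.
Qed.

Lemma aorder_nonbranch m : p.2 != 0 -> (0 < m < n + n)%N -> kills P m -> aorder P m.
Proof.
move=> p2 /andP[m0 mn] mP; split=> // k0 /andP[k00 k0m] k0P.
have ex : exists k, (0 < k)%N && `[< kills P k >] by exists k0; rewrite k00;
  exact/asboolP.
case: (ex_minnP ex) => k /andP[k_gt0 /asboolP kP] kmin.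
have kk0 : (k <= k0)%N by apply: kmin; rewrite k00; exact/asboolP.
have /dvdnP[q mE] : (k %| m)%N.
  rewrite /dvdn; apply: contraT; rewrite -lt0n => r0.
  have /kmin : (0 < m %% k)%N && `[< kills P (m %% k) >].
    by rewrite r0; apply/asboolP; exact: kills_modn.
  by rewrite leqNgt ltn_pmod.
(* A proper divisor of m is at most m / 2, hence below n. *)
have kn : (k < n)%N.
  have : (1 < q)%N by case: q mE => [|[|q]]; rewrite ?mul0n ?mul1n //; lia.
  by move: mn; rewrite mE; nia.
have kn0 : (0 < k < n)%N by rewrite k_gt0.
by have [/eqP] := kills_small kn0 kP; rewrite (negPf p2).
Qed.

End Affine.
End Kills.

(** * Normal form *)

(** All d terms have the same degree and the same leading coefficient, so these add up to d times a
    nonzero constant. This gives the degree of p - q from that of p^d - q^d. *)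
Lemma size_power_quotient (K : fieldType) (d l : nat) (p q : {poly K}) :
    d%:R != 0 :> K -> size p = l.+1 -> size q = l.+1 -> lead_coef p = lead_coef q ->
  size (\sum_(i < d) p ^+ (d.-1 - i) * q ^+ i) = (d.-1 * l).+1.
Proof.
move=> d0 sp sq lpq.
have l0 : lead_coef q != 0 by rewrite lead_coef_eq0 -size_poly_gt0 sq.
have p0 : p != 0 by rewrite -size_poly_gt0 sp.
have q0 : q != 0 by rewrite -size_poly_gt0 sq.
have sX (r : {poly K}) k : size r = l.+1 -> r != 0 -> size (r ^+ k) = (l * k).+1.
  move=> sr r0; have := size_exp r k; rewrite sr /= => <-; rewrite prednK //.
  by rewrite size_poly_gt0 expf_neq0.
have st (i : 'I_d) : size (p ^+ (d.-1 - i) * q ^+ i) = (d.-1 * l).+1.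
  rewrite size_mul ?expf_neq0 // !sX // addSn /= addnS -mulnDr subnK 1?mulnC //.
  by have := ltn_ord i; lia.
have top : (\sum_(i < d) p ^+ (d.-1 - i) * q ^+ i)`_(d.-1 * l) = lead_coef q ^+ d.-1 *+ d.
  rewrite coef_sum (eq_bigr (fun=> lead_coef q ^+ d.-1)) ?sumr_const ?card_ord // => i _.
  have -> : (p ^+ (d.-1 - i) * q ^+ i)`_(d.-1 * l) = lead_coef (p ^+ (d.-1 - i) * q ^+ i).
    by rewrite lead_coefE st.
  rewrite lead_coefM !lead_coef_exp lpq -exprD subnK //.
  by have := ltn_ord i; lia.
apply/eqP; rewrite eqn_leq; apply/andP; split.
  by apply: (leq_trans (size_sum _ _ _)); apply/bigmax_leqP => i _; rewrite st.
rewrite ltnNge; apply/negP => le_top; move/eqP: top.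
rewrite nth_default // eq_sym -mulr_natr mulf_eq0 expf_eq0 (negPf l0) (negPf d0).
by rewrite andbF.
Qed.

Lemma size2_poly (K : fieldType) (e : {poly K}) a : size e = 2%N ->
  e = e`_1 *: ('X - a%:P) + (e.[a])%:P.
Proof.
move=> se; have := coefK e; rewrite poly_def se !big_ord_recl big_ord0 /= addr0.
rewrite expr0 expr1 alg_polyC; move: (e`_0) (e`_1) => e0 e1 <-.
by rewrite !hornerE -!mul_polyC polyCD polyCM; ring.
Qed.

Section NormalForm.
Variables (K : closedFieldType) (f : {poly K}) (d n l : nat) (L : fieldType).
Local Notation A := {poly {poly K}}.
Variable phi : {rmorphism A -> L}.
Hypothesis S : smooth_model f d n phi.
Let M := smooth_model_model S.
Let d_gt0 := model_d_gt0 M.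
Let d_gt1 := smooth_model_d_gt1 S.
Let d_char := smooth_model_char S.
Hypotheses (l_ge2 : (2 <= l)%N) (l_le : (l <= d)%N) (nE : (n + l = (d * l).+1)%N).
Variables (P : point f d) (p : K * K).
Hypothesis PE : val P = Some p.
Local Notation X_a := ('X - p.1%:P).

Let dl_le : (2 * l <= d * l)%N. Proof. by rewrite leq_mul2r d_gt1 orbT. Qed.

Lemma normal_form_of_order : aorder phi P (d * l) -> p.2 != 0 /\
  exists B B1, [/\ B != 0, B1 != 0 &
    f = (B *: X_a ^+ l + B1 *: X_a + p.2%:P) ^+ d - (B *: X_a ^+ l) ^+ d].
Proof.
move=> [_ Pm Pmin].
(* Otherwise d (P) - d (O) would already be principal, with d < d l. *)
have b0 : p.2 != 0.
  apply/negP => /eqP /(kills_branch S PE); apply: Pmin.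
  by rewrite d_gt0 -{1}[d]muln1 ltn_mul2l d_gt0.
split=> //.
have [u [su ku uk uP uz]] := killsE S PE Pm.
have {}uP : at_point p u = 0 by apply: uP; rewrite muln_gt0 d_gt0; lia.
set c := u`_0; set c1 := (u`_1)`_0.
(* Weights are at most d l = n + l - 1. This excludes x y, of weight n + d, because l <= d, and y^2,
   of weight 2n. *)
have uE : u = c%:P + c1%:P%:P * 'X.
  apply/polyP => j; rewrite coefD coefC coefMX.
  case: j => [|[|j]] /=; first by rewrite addr0.
    rewrite add0r coefC eqxx /=; apply/polyP => i; rewrite coefC; case: i => [//|i] /=.
    apply/eqP; apply: contraT => /ku; rewrite muln1 mulnS => H; exfalso.
    move: H nE l_le; move: (d * i)%N (d * l)%N; lia.
  rewrite coefC /= add0r; apply/polyP => i; rewrite coef0.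
  apply/eqP; apply: contraT => /ku; rewrite !mulnS => H; exfalso.
  move: H nE dl_le l_ge2; move: (d * i)%N (d * l)%N (n * j)%N; lia.
have atE q : at_point q u = c.[q.1] + c1 * q.2.
  by rewrite uE at_pointD at_pointM at_pointX !at_pointC hornerC.
(* A polynomial in x alone cannot have P as its only zero unless P is a branch point. *)
have c10 : c1 != 0.
  apply: contraNneq b0 => c10; have uC : u = c%:P by rewrite uE c10 !polyC0 mul0r addr0.
  rewrite uC in uk uz; apply/eqP; apply: (branch_of_constant S _ uk uz).
  by rewrite muln_gt0 d_gt0; lia.
have sc_le : (size c <= l.+1)%N.
  apply/leq_sizeP => i li; apply/eqP; apply: contraT => /ku; rewrite muln0 addn0 ltnS.
  by rewrite leq_mul2l gtn_eqF //= leqNgt li.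
(* The weight d l must be reached, and y has weight n < d l, so it comes from x^l. *)
have cl : c`_l != 0.
  apply: contra_notN (wt_nwlt M uk) => /eqP cl0 i j.
  rewrite uE coefD coefC coefMX; case: j => [|[|j]] /=.
  - rewrite addr0 muln0 addn0 => ci; rewrite ltn_mul2l d_gt0 /= ltn_neqAle.
    apply/andP; split; first by apply: contraNneq ci => ->; rewrite cl0.
    by rewrite -ltnS; apply: leq_trans sc_le; rewrite ltnNge;
      apply: contraNN ci => ?; rewrite nth_default.
  - rewrite add0r coefC eqxx coefC; case: i => [|i]; last by rewrite eqxx.
    by rewrite muln0 muln1 add0n => _; move: nE l_ge2; lia.
  by rewrite coefC add0r coef0 eqxx.
have sc : size c = l.+1.
  by apply/eqP; rewrite eqn_leq sc_le ltnNge; apply: contraNN cl => ?;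
    rewrite nth_default.
pose c' := - c1^-1 *: c.
have ic0 : - c1^-1 != 0 by rewrite oppr_eq0 invr_eq0.
have sc' : size c' = l.+1 by rewrite size_scale.
have at0 q : at_point q u = 0 <-> q.2 = c'.[q.1].
  rewrite atE hornerZ; split=> [/eqP|->].
    rewrite addr_eq0 => /eqP->; rewrite mulrNN mulKf //.
  by rewrite mulrA mulrN mulfV // mulN1r subrr.
have c'a : c'.[p.1] = p.2 by symmetry; apply/at0.
pose B := lead_coef c'.
have B0 : B != 0 by rewrite lead_coef_eq0 -size_poly_gt0 sc'.
have c'0 : c' != 0 by rewrite -size_poly_gt0 sc'.
have scd : size (c' ^+ d) = (d * l).+1.
  have := size_exp c' d; rewrite sc' /= mulnC => <-; rewrite prednK //.
  by rewrite size_poly_gt0 expf_neq0.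
have sfd : (size (- f) < size (c' ^+ d))%N.
  by rewrite size_polyN (model_size M) scd; move: nE l_ge2; lia.
(* A root r of the left side gives a point (r, c'(r)) of the curve where u vanishes, hence P. As n <
   d l, the degree and leading coefficient are those of c'^d. *)
have NE : c' ^+ d - f = (B *: X_a ^+ l) ^+ d.
  have N0 : c' ^+ d - f != 0 by rewrite -size_poly_gt0 (size_polyDl sfd) scd.
  rewrite (all_roots_eq N0 (a := p.1)); last first.
    move=> r; rewrite /root hornerD hornerN horner_exp subr_eq0 => /eqP rE.
    by rewrite -(uz (r, c'.[r]) rE) //; exact/at0.
  by rewrite (lead_coefDl sfd) lead_coef_exp (size_polyDl sfd) scd /= exprZn -exprM mulnC.
have fE : f = c' ^+ d - (B *: X_a ^+ l) ^+ d by rewrite -NE opprB addrC subrK.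
pose e := c' - B *: X_a ^+ l.
have sq : size (B *: X_a ^+ l) = l.+1 by rewrite size_scale // size_exp_XsubC.
have lq : lead_coef c' = lead_coef (B *: X_a ^+ l).
  by rewrite [RHS]lead_coefZ (monicP (monic_exp l (monicXsubC p.1))) mulr1.
(* The cofactor of e in f has degree (d - 1) l = n - 1, so e has degree 1. *)
have se : size e = 2.
  have := fE; rewrite subrXX -/e => fE'.
  have f0 : f != 0 by rewrite -size_poly_gt0 (model_size M).
  have e0 : e != 0 by apply: contraNneq f0 => e0; rewrite fE' e0 mul0r.
  have s0 : \sum_(i < d) c' ^+ (d.-1 - i) * (B *: X_a ^+ l) ^+ i != 0.
    by rewrite -size_poly_gt0 (size_power_quotient d_char sc' sq lq).
  have := size_mul e0 s0.
  rewrite -fE' (model_size M) (size_power_quotient d_char sc' sq lq).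
  have : (d.-1 * l + l = d * l)%N by rewrite addnC -mulSn prednK.
  by move: (size e) (d.-1 * l)%N (d * l)%N nE; clear; lia.
have eE : e = e`_1 *: X_a + p.2%:P.
  have ea : e.[p.1] = p.2.
    by rewrite /e hornerD hornerN c'a !hornerE subrr expr0n gtn_eqF ?mulr0 ?subr0 // ltnW.
  by rewrite -ea; exact: size2_poly.
exists B, e`_1; split=> //.
  by have := lead_coef_eq0 e; rewrite lead_coefE se -size_poly_eq0 se /= => ->.
by rewrite -addrA -eE /e addrC subrK.
Qed.

End NormalForm.

(** * The Jacobian *)

Record smooth_curve (K : closedFieldType) (f : {poly K}) (d n : nat) : Prop :=
  SmoothCurve {
    curve_d_gt1 : (1 < d)%N;
    curve_size : size f = n.+1;
    curve_coprime : coprime n d;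
    curve_char : d%:R != 0 :> K;
    curve_sqfree : no_repeated_roots f
  }.

Section Concrete.
Variables (K : closedFieldType) (f : {poly K}) (d n : nat).
Hypothesis C : smooth_curve f d n.
Local Notation A := {poly {poly K}}.
Local Notation eqF := (map_poly (@tofrac {poly K}) ('X^d - f%:P : A)).

Let d_gt0 : (0 < d)%N. Proof. exact: ltnW (curve_d_gt1 C). Qed.

Definition curve_irreducible : monic_irreducible_poly eqF :=
  eqF_irreducible d_gt0 (curve_size C) (curve_coprime C).

(** Convertible to [funfield f d]; irreducibility adds the field structure, and later proofs pass
    between the two by conversion. *)
Definition curve_field : fieldType := {poly %/ eqF with curve_irreducible}.

Definition curve_phi : {rmorphism A -> curve_field} := @funxy K f d.

Lemma curve_phiE u : curve_phi u = @funxy K f d u. Proof. by []. Qed.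

Lemma curve_model_phi : curve_model f d n curve_phi.
Proof.
split; [exact: d_gt0 | exact: curve_size C | exact: curve_coprime C | |].
  by rewrite curve_phiE; exact: funxy_eqC.
by move=> u; rewrite curve_phiE; exact: funxy_inj0.
Qed.

Lemma funfield_frac (g : funfield f d) : exists2 q : {poly K}, q != 0 &
  exists u : A, g * funxy f d q%:P = funxy f d u.
Proof.
have [q q0 [u uE]] := clear_denom (polyn g); exists q => //; exists u.
have gE : g = in_qpoly eqF (polyn g).
  by apply: val_inj; rewrite /= Pdiv.CommonRing.rmodp_small // size_mk_monic.
rewrite {1}gE /funxy -in_qpolyM; congr (in_qpoly _ _).
rewrite -[RHS]uE map_polyC /= mulrC; exact: mul_polyC.
Qed.

Lemma smooth_model_phi : smooth_model f d n curve_phi.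
Proof.
split; [exact: curve_model_phi | exact: funfield_frac | exact: curve_d_gt1 C |
  exact: curve_char C | exact: curve_sqfree C].
Qed.

Lemma funfield_unit (g : funfield f d) : (g \is a GRing.unit) = (g != 0).
Proof. exact: (unitfE (g : curve_field)). Qed.

Lemma is_valuationP (v : funfield f d -> int) :
  is_valuation v <-> kvaluation curve_phi v.
Proof.
by split=> [[v0 vM vD vC vn]|[[v0 vM vD] vC vn]]; split.
Qed.

Lemma ordE P : @ord K f d P = aord curve_phi P.
Proof.
rewrite /ord; case: xgetP => [v _ [/is_valuationP vk vc]|/(_ (aord curve_phi P))].
  exact/esym/(aord_unique smooth_model_phi).
by case; have [/is_valuationP] := aord_spec smooth_model_phi P.
Qed.

Lemma to_jacobianMn_eq0 P k :
  (to_jacobian P *+ k == 0 :> jacobian f d) <-> kills curve_phi P k.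
Proof.
rewrite /to_jacobian -raddfMn /= -(raddf0 (\pi_(Quotient.quot (@principal K f d)))%qT).
rewrite -Quotient.idealrBE subr0.
set D := Divisor0 _ *+ k.
(* The formula covers P = O too, where the two indicators cancel. *)
have DE Q : coeff Q (val D) = (Q == P)%:Z * k%:Z - (Q == infty)%:Z * k%:Z.
  rewrite /D raddfMn /= raddfMn /= raddfB /= !coeffU !mul1r ![_ == Q]eq_sym.
  case: (Q == P); case: (Q == infty);
    by rewrite ?subrr ?subr0 ?sub0r ?mul0rn ?mulNrn ?mul1r ?mul0r ?subrr ?subr0
      ?sub0r ?natz.
split=> [/asboolP[g Ug gE]|[g g0 gE]].
  by exists g; [rewrite -funfield_unit | move=> Q; rewrite -DE -ordE gE].
apply/asboolP; exists g; first by rewrite funfield_unit.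
by move=> Q; rewrite DE ordE gE.
Qed.

Lemma point_orderE (P : point f d) m : point_order P m <-> aorder curve_phi P m.
Proof.
split=> [[m0 /eqP/to_jacobianMn_eq0 Pm Pmin]|[m0 /to_jacobianMn_eq0/eqP Pm Pmin]].
  by split=> // k km /to_jacobianMn_eq0; apply/negP; exact: Pmin.
by split=> // k km; apply/negP => /to_jacobianMn_eq0; exact: Pmin.
Qed.

End Concrete.

(** * Isomorphisms *)

(** One inclusion of kernels makes u / w |-> theta u / theta w well defined; the other keeps the
    image of a denominator nonzero. *)
Lemma frac_extension (A : comNzRingType) (L1 L2 : fieldType)
    (phi : {rmorphism A -> L1}) (theta : {rmorphism A -> L2}) :
    (forall g, exists u w, phi w != 0 /\ g * phi w = phi u) ->
    (forall u, phi u = 0 <-> theta u = 0) ->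
  exists Theta : {rmorphism L1 -> L2}, forall u, Theta (phi u) = theta u.
Proof.
move=> frac ker.
have th0 u : phi u != 0 -> theta u != 0 by apply: contraNN => /eqP/ker->.
have th_eq u w : phi u = phi w -> theta u = theta w.
  move=> E; apply/eqP; rewrite -subr_eq0 -rmorphB; apply/eqP/ker.
  by rewrite rmorphB E subrr.
have [T TE] : exists T : L1 -> L2, forall g u w,
    phi w != 0 -> g * phi w = phi u -> T g * theta w = theta u.
  have /choice[T TE] : forall g, exists h, forall u w,
      phi w != 0 -> g * phi w = phi u -> h * theta w = theta u.
    move=> g; have [u [w [w0 gE]]] := frac g; exists (theta u / theta w) => u' w' w'0 gE'.
    apply: (mulIf (th0 _ w0)); rewrite mulrAC divfK ?th0 // -!rmorphM.
    by apply: th_eq; rewrite !rmorphM /= -gE -gE'; ring.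
  by exists T.
have TB : zmod_morphism T.
  move=> g h; have [u [w [w0 gE]]] := frac g; have [u' [w' [w'0 hE]]] := frac h.
  have ww0 : phi (w * w') != 0 by rewrite rmorphM mulf_neq0.
  apply: (mulIf (th0 _ ww0)).
  have -> : T (g - h) * theta (w * w') = theta (u * w' - u' * w).
    by apply: TE => //; rewrite rmorphB !rmorphM /= -gE -hE; ring.
  by rewrite rmorphB !rmorphM /= -(TE _ _ _ w0 gE) -(TE _ _ _ w'0 hE); ring.
have TM : monoid_morphism T.
  split.
    by have := TE 1 1 1; rewrite !rmorph1 oner_neq0 !mulr1; apply.
  move=> g h; have [u [w [w0 gE]]] := frac g; have [u' [w' [w'0 hE]]] := frac h.
  have ww0 : phi (w * w') != 0 by rewrite rmorphM mulf_neq0.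
  apply: (mulIf (th0 _ ww0)).
  have -> : T (g * h) * theta (w * w') = theta (u * u').
    by apply: TE => //; rewrite !rmorphM /= -gE -hE; ring.
  by rewrite !rmorphM /= -(TE _ _ _ w0 gE) -(TE _ _ _ w'0 hE); ring.
pose aT := GRing.isZmodMorphism.Build L1 L2 T TB.
pose mT := GRing.isMonoidMorphism.Build L1 L2 T TM.
pose Theta : {rmorphism L1 -> L2} := HB.pack T aT mT.
exists Theta => u; have := TE (phi u) u 1; rewrite !rmorph1 oner_neq0 !mulr1; exact.
Qed.

Lemma rmorph_poly2_ext (K R : comNzRingType) (s t : {rmorphism {poly {poly K}} -> R}) :
  (forall c, s c%:P%:P = t c%:P%:P) -> s 'X%:P = t 'X%:P -> s 'X = t 'X -> s =1 t.
Proof.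
move=> sC sX sY u; rewrite -[u]coefK poly_def !rmorph_sum; apply: eq_bigr => j _.
rewrite -mul_polyC !rmorphM !rmorphXn sY; congr (_ * _).
rewrite -[u`_j]coefK poly_def !rmorph_sum; apply: eq_bigr => i _.
by rewrite -mul_polyC !rmorphM !rmorphXn /= sC sX.
Qed.

(** * Affine changes of coordinates *)

Section Substitution.
Variables (K : closedFieldType).
Local Notation A := {poly {poly K}}.

(* x |-> x + a, y |-> b y *)
Definition subst_poly (a b : K) : A -> A :=
  horner_eval (b%:P%:P * 'X) \o map_poly (polyC \o comp_poly ('X + a%:P)).

HB.instance Definition _ a b := GRing.RMorphism.on (subst_poly a b).

Lemma subst_polyC a b p : subst_poly a b p%:P = (p \Po ('X + a%:P))%:P.
Proof. by rewrite /subst_poly /= map_polyC /horner_eval hornerC. Qed.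

Lemma subst_polyY a b : subst_poly a b 'X = b%:P%:P * 'X.
Proof. by rewrite /subst_poly /= map_polyX /horner_eval hornerX. Qed.

Lemma subst_polyB a b u w : subst_poly a b (u - w) = subst_poly a b u - subst_poly a b w.
Proof. by apply: (addIr (subst_poly a b w)); rewrite -rmorphD !subrK. Qed.

Lemma subst_polyM a b u w : subst_poly a b (u * w) = subst_poly a b u * subst_poly a b w.
Proof. exact: rmorphM. Qed.

Lemma subst_polyXn a b u k : subst_poly a b (u ^+ k) = subst_poly a b u ^+ k.
Proof. exact: rmorphXn. Qed.

Lemma subst_polyK a b : b != 0 -> cancel (subst_poly a b) (subst_poly (- a) b^-1).
Proof.
move=> b0; apply: (@rmorph_poly2_ext _ _ (subst_poly (- a) b^-1 \o subst_poly a b) idfun).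
- by move=> c; rewrite /= !subst_polyC !comp_polyC.
- rewrite /= subst_polyC comp_polyX subst_polyC comp_polyD comp_polyX comp_polyC.
  by rewrite polyCN addrNK.
rewrite /= subst_polyY rmorphM /= subst_polyC comp_polyC subst_polyY mulrA -!polyCM.
by rewrite mulfV // !polyC1 mul1r.
Qed.

Lemma coefs_in_subst (K0 : divringClosed K) a b u : a \in K0 -> b \in K0 ->
  coefs_in K0 u -> coefs_in K0 (subst_poly a b u).
Proof.
move=> aK bK uK; rewrite -[u]coefK poly_def rmorph_sum.
have sumK (I : Type) (r : seq I) (F : I -> A) :
    (forall i, coefs_in K0 (F i)) -> coefs_in K0 (\sum_(i <- r) F i).
  move=> FK; elim/big_ind: _ => //; first by move=> i j; rewrite !coef0 rpred0.
  by move=> x y xK yK i j; rewrite !coefD rpredD.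
apply: sumK => j; rewrite -mul_polyC rmorphM rmorphXn /= subst_polyC subst_polyY.
apply: coefs_inM.
  apply: coefs_inC; apply: polyOver_comp; first by apply/polyOverP => i; apply: uK.
  by rewrite polyOverXaddC.
rewrite exprMn -!rmorphXn; apply: coefs_inM; last exact: coefs_inXn.
by apply: coefs_inC; rewrite polyOverC rpredX.
Qed.

End Substitution.

(* (x, y) |-> (x + a, b y) maps y^d = f(x) onto y^d = g(x). *)
Definition twist (K : closedFieldType) (d : nat) (a b : K) (g f : {poly K}) : Prop :=
  g \Po ('X + a%:P) = b ^+ d *: f.

Lemma twist_inv (K : closedFieldType) d (a b : K) g f :
  b != 0 -> twist d a b g f -> twist d (- a) b^-1 f g.
Proof.
move=> b0 tw; rewrite /twist -[f]scale1r -(mulVf (expf_neq0 d b0)) -scalerA -tw.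
rewrite comp_polyZ -comp_polyA comp_polyD comp_polyX comp_polyC polyCN addrNK.
by rewrite comp_polyXr exprVn.
Qed.

Lemma subst_curve (K : closedFieldType) d (a b : K) g f : twist d a b g f ->
  subst_poly a b ('X^d - g%:P) = (b ^+ d)%:P%:P * ('X^d - f%:P).
Proof.
move=> tw; rewrite subst_polyB subst_polyXn.
rewrite subst_polyC subst_polyY tw exprMn mulrBr -mul_polyC polyCM.
by rewrite !polyC_exp.
Qed.

Lemma subst_ker (K : closedFieldType) (f g : {poly K}) (d n : nat) (L1 L2 : comNzRingType)
    (phi1 : {rmorphism {poly {poly K}} -> L1}) (phi2 : {rmorphism {poly {poly K}} -> L2})
    a b u :
    curve_model g d n phi1 -> curve_model f d n phi2 -> twist d a b g f ->
  phi1 u = 0 -> phi2 (subst_poly a b u) = 0.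
Proof.
move=> M1 M2 tw /(model_ker M1)[q ->]; rewrite subst_polyM.
by rewrite (subst_curve tw) !rmorphM (model_eq M2) !mulr0.
Qed.

(** The substitution sends y^d - g to a multiple of y^d - f, and the inverse twist gives the reverse
    inclusion of kernels, so it passes to fractions. *)
Lemma pullback_exists (K : closedFieldType) (f g : {poly K}) (d n : nat)
    (L1 L2 : fieldType) (phi1 : {rmorphism {poly {poly K}} -> L1})
    (phi2 : {rmorphism {poly {poly K}} -> L2}) a b :
    smooth_model g d n phi1 -> smooth_model f d n phi2 -> b != 0 -> twist d a b g f ->
  exists T : {rmorphism L1 -> L2}, forall u, T (phi1 u) = phi2 (subst_poly a b u).
Proof.
move=> S1 S2 b0 tw; have M1 := smooth_model_model S1; have M2 := smooth_model_model S2.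
apply: (@frac_extension _ _ _ phi1 (phi2 \o subst_poly a b)); first exact: (phi_frac S1).
move=> u; split=> [|/= u0]; first exact: (subst_ker M1 M2 tw).
rewrite -(subst_polyK a b0 u); apply: (subst_ker M2 M1 _ u0).
exact: twist_inv.
Qed.

Lemma pullback_kvaluation (K : closedFieldType) (L1 L2 : fieldType)
    (phi1 : {rmorphism {poly {poly K}} -> L1}) (phi2 : {rmorphism {poly {poly K}} -> L2})
    (T : {rmorphism L1 -> L2}) :
    bijective T -> (forall c, T (phi1 c%:P%:P) = phi2 c%:P%:P) ->
  forall v, kvaluation phi2 v -> kvaluation phi1 (v \o T).
Proof.
move=> [T' TK T'K] TC v [[v0 vM vD] vC [t t0 vt]]; split.
- split=> [|h k h0 k0|h k h0 k0 hk0]; rewrite /= ?rmorph0 //.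
    by rewrite rmorphM vM // fmorph_eq0.
  by rewrite rmorphD vD // -?rmorphD fmorph_eq0.
- by move=> c; rewrite /= TC.
exists (T' t); first by rewrite -(fmorph_eq0 T) T'K.
by rewrite /= T'K.
Qed.

Section Pullback.
Variables (K : closedFieldType) (f g : {poly K}) (d n : nat).
Hypotheses (Cf : smooth_curve f d n) (Cg : smooth_curve g d n).
Variable T : {rmorphism funfield g d -> funfield f d}.
Hypotheses (T_bij : bijective T) (TC : forall c, T (funC g d c) = funC f d c).

(** The same map seen between fields, so that injectivity and compatibility with inverses come for
    free. *)
Definition field_pullback : {rmorphism curve_field Cg -> curve_field Cf} := T.

End Pullback.

(** * Orders of points under isomorphisms *)

Section IsoOrder.
Variables (K : closedFieldType) (K0 : divringClosed K) (f g : {poly K}) (d n : nat).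
Hypotheses (Cf : smooth_curve f d n) (Cg : smooth_curve g d n).
Variable Psi : curve_iso K0 f g d.
Local Notation phif := (curve_phi Cf).
Local Notation phig := (curve_phi Cg).
Local Notation T := (field_pullback Cf Cg (iso_pb Psi)).

Lemma iso_regular P (h : curve_field Cg) : h != 0 ->
  (0 <= aord phig (Psi P) h) <-> (0 <= aord phif P (T h)).
Proof.
move=> h0; have Th0 : T h != 0 by rewrite fmorph_eq0.
have := iso_pb_regular Psi P h; rewrite /regular (ordE Cf) (ordE Cg) => -[H1 H2].
split=> H; [case: (H1 (or_intror H)) | case: (H2 (or_intror H))] => // /eqP.
  by rewrite -[_ == 0]/(T h == 0) (negPf Th0).
by rewrite -[_ == 0]/(h == 0) (negPf h0).
Qed.

(** A nonzero h has positive order exactly when 1 / h is not regular, so matching regular functions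
    also matches zeros. *)
Lemma iso_pos P (h : curve_field Cg) :
  0 < aord phig (Psi P) h -> 0 < aord phif P (T h).
Proof.
have vg := aord_valuation (smooth_model_phi Cg) (Psi P).
have vf := aord_valuation (smooth_model_phi Cf) P.
move=> h_gt0; have h0 : h != 0.
  by apply: contraTneq h_gt0 => ->; rewrite (valuation0 vg) ltxx.
rewrite ltNge; apply/negP => Th_le0.
have hV0 : h^-1 != 0 by rewrite invr_eq0.
have := (iso_regular P hV0).2; rewrite fmorphV (valuationV vf) (valuationV vg).
by rewrite !oppr_ge0 => /(_ Th_le0); rewrite leNgt h_gt0.
Qed.

(** The valuation at P composed with the pullback is normalized and centered at the image of P, so
    uniqueness of the place applies. *)
Lemma iso_ord P (h : curve_field Cg) : aord phig (Psi P) h = aord phif P (T h).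
Proof.
suff -> : aord phig (Psi P) = aord phif P \o T by [].
apply: (aord_unique (smooth_model_phi Cg)).
  apply: (@pullback_kvaluation _ _ _ _ phif T (iso_pb_bij Psi) (iso_pbC Psi)).
  by have [] := aord_spec (smooth_model_phi Cf) P.
have [_] := aord_spec (smooth_model_phi Cg) (Psi P).
case: (val (Psi P)) => [[a b] [/= ha hb]|/= hX]; first by split; apply: iso_pos.
rewrite ltNge; apply/negP => TX.
have X0 : phig 'X%:P != 0 by rewrite (phiC_eq0 (smooth_model_phi Cg)) polyX_eq0.
by have := (iso_regular P X0).2 TX; rewrite leNgt hX.
Qed.

Lemma kills_iso P k : Psi infty = infty -> kills phif P k <-> kills phig (Psi P) k.
Proof.
move=> Pi; have PsiE Q Q' : (Psi Q == Psi Q') = (Q == Q').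
  by rewrite (inj_eq (can_inj (iso_mapK Psi))).
split=> [[h h0 hE]|[h h0 hE]].
  have [T' TK T'K] := iso_pb_bij Psi.
  have hT : T (T' h) = h by exact: T'K.
  exists (T' h : curve_field Cg); first by rewrite -(fmorph_eq0 T) hT.
  by move=> Q; rewrite -(iso_invK Psi Q) iso_ord hT hE -Pi !PsiE.
exists (T h); first by rewrite fmorph_eq0.
by move=> Q; rewrite -iso_ord hE -Pi !PsiE.
Qed.

Lemma point_order_iso P k : Psi infty = infty -> point_order P k <-> point_order (Psi
  P) k.
Proof.
move=> Pi; rewrite (point_orderE Cf) (point_orderE Cg).
split=> -[k0 Pk Pmin]; split=> //; first exact/kills_iso.
- by move=> l lk /(kills_iso P l Pi); exact: Pmin.
- exact/kills_iso.
by move=> l lk /(kills_iso P l Pi); exact: Pmin.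
Qed.

End IsoOrder.

Section TwistMap.
Variables (K : closedFieldType) (d : nat) (a b : K) (f g : {poly K}).
Hypothesis tw : twist d a b g f.

Lemma twist_on_curve (P : point f d) :
  on_curve g d (omap (fun q => (q.1 + a, b * q.2)) (val P)).
Proof.
case: (val P) (valP P) => [[x y]|//] /= /eqP yd.
have := congr1 (fun p => p.[x]) tw; rewrite horner_comp !hornerE => ->.
by rewrite exprMn yd.
Qed.

Definition twist_map (P : point f d) : point g d := Point (twist_on_curve P).

End TwistMap.

Lemma twist_mapK (K : closedFieldType) (d : nat) (a b : K) (f g : {poly K})
    (tw : twist d a b g f) (tw' : twist d (- a) b^-1 f g) :
  b != 0 -> cancel (twist_map tw) (twist_map tw').
Proof.
move=> b0 P; apply: val_inj => /=; case: (val P) => [[x y]|] //=.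
by rewrite addrK mulKf.
Qed.

Lemma rational_fun_coefs (K : closedFieldType) (f : {poly K}) (d : nat)
    (K0 : divringClosed K) (h : funfield f d) :
  rational_fun K0 h <-> exists u w, [/\ coefs_in K0 u, coefs_in K0 w,
    funxy f d w \is a GRing.unit & h = funxy f d u / funxy f d w].
Proof.
by split=> -[u [w [/coefs_inP uK /coefs_inP wK w0 hE]]]; exists u, w.
Qed.

Lemma twist_centered (K : closedFieldType) (d n : nat) (a b : K) (f : {poly K})
    (L1 L2 : fieldType) (phi1 : {rmorphism {poly {poly K}} -> L1})
    (phi2 : {rmorphism {poly {poly K}} -> L2}) (T : {rmorphism L1 -> L2})
    (P : option (K * K)) v :
    smooth_model f d n phi2 -> (forall u, T (phi1 u) = phi2 (subst_poly a b u)) ->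
    b != 0 -> kvaluation phi2 v -> centered_at phi2 P v ->
  centered_at phi1 (omap (fun q => (q.1 + a, b * q.2)) P) (v \o T).
Proof.
move=> S TE b0 [vv vC _]; case: P => [[x y] /= [vx vy]|/= vX].
  rewrite !rmorphB !TE !subst_polyC comp_polyX !comp_polyC subst_polyY; split.
    by rewrite !polyCD !rmorphD opprD addrACA subrr addr0.
  rewrite !polyCM !rmorphM -mulrBr; have [E|yn] := eqVneq (phi2 'X - phi2 y%:P%:P) 0.
    by move: vy; rewrite E (valuation0 vv) ltxx.
  by rewrite (valuationM vv) ?vC ?add0r // (phiC_eq0 S) polyC_eq0.
rewrite TE subst_polyC comp_polyX polyCD rmorphD ltNge; apply/negP => H.
have Hge : vge v 0 (phi2 'X%:P + phi2 a%:P%:P) by rewrite /vge H orbT.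
have Ha : vge v 0 (phi2 a%:P%:P) by rewrite /vge vC lexx orbT.
have := vgeB vv Hge Ha; rewrite addrK /vge (phiC_eq0 S) polyX_eq0 /=.
by rewrite leNgt vX.
Qed.

Lemma pullback_cancel (K : closedFieldType) (d n : nat) (g : {poly K})
    (L1 L2 : fieldType) (phi1 : {rmorphism {poly {poly K}} -> L1})
    (phi2 : {rmorphism {poly {poly K}} -> L2})
    (T : {rmorphism L1 -> L2}) (T' : {rmorphism L2 -> L1}) s s' :
    smooth_model g d n phi1 -> (forall u, T (phi1 u) = phi2 (s u)) ->
    (forall u, T' (phi2 u) = phi1 (s' u)) -> cancel s s' -> cancel T T'.
Proof.
move=> S TE T'E sK h; have [u [w [w0 hE]]] := phi_frac S h; apply: (mulIf w0).
by rewrite hE -{1}(sK w) -T'E -TE -rmorphM -rmorphM hE TE T'E sK.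
Qed.

Section TwistField.
Variables (K : closedFieldType) (K0 : divringClosed K) (d n : nat) (a b : K).
Variables (f g : {poly K}).
Hypotheses (Cf : smooth_curve f d n) (Cg : smooth_curve g d n).
Local Notation phif := (curve_phi Cf).
Local Notation phig := (curve_phi Cg).
Variable T : {rmorphism curve_field Cg -> curve_field Cf}.
Hypothesis TE : forall u, T (phig u) = phif (subst_poly a b u).

Lemma twist_rational (h : curve_field Cg) : a \in K0 -> b \in K0 ->
  @rational_fun K g d K0 h -> @rational_fun K f d K0 (T h).
Proof.
move=> aK bK /rational_fun_coefs[u [w [uK wK w0 hE]]].
have w1 : phig w != 0 by exact: (etrans (esym (funfield_unit Cg _)) w0).
have w2 : phif (subst_poly a b w) != 0 by rewrite -TE fmorph_eq0.
apply/rational_fun_coefs; exists (subst_poly a b u), (subst_poly a b w).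
split; [exact: coefs_in_subst | exact: coefs_in_subst | |].
  exact: (etrans (funfield_unit Cf _) w2).
transitivity (T (phig u / phig w)); first by congr (T _); exact: hE.
transitivity (T (phig u) / T (phig w)); first exact: (fmorph_div T).
by congr (_ / _); exact: TE.
Qed.

End TwistField.

(** The inverse substitution is a twist over K_0 as well; it supplies both the inverse pullback and
    the converse implication for rational functions. *)
Lemma twist_iso (K : closedFieldType) (K0 : divringClosed K) (d n : nat) (a b : K)
    (f g : {poly K}) (Cf : smooth_curve f d n) (Cg : smooth_curve g d n) :
    a \in K0 -> b \in K0 -> b != 0 -> twist d a b g f ->
  exists Psi : curve_iso K0 f g d, forall P,
    val (Psi P) = omap (fun q => (q.1 + a, b * q.2)) (val P).
Proof.
move=> aK bK b0 tw; have tw' := twist_inv b0 tw.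
have Sf := smooth_model_phi Cf; have Sg := smooth_model_phi Cg.
have [T TE] := pullback_exists Sg Sf b0 tw.
have b'0 : b^-1 != 0 by rewrite invr_eq0.
have [T' T'E] := pullback_exists Sf Sg b'0 tw'.
have TK : cancel T T' by exact: (pullback_cancel Sg TE T'E (subst_polyK a b0)).
have T'K : cancel T' T.
  apply: (pullback_cancel Sf T'E TE) => v.
  by have := subst_polyK (- a) b'0 v; rewrite opprK invrK.
have T_bij : bijective T by exists T'.
have TC c : T (curve_phi Cg c%:P%:P) = curve_phi Cf c%:P%:P.
  apply: (etrans (TE _)); congr (curve_phi Cf _).
  by rewrite subst_polyC comp_polyC.
have ordT P h : aord (curve_phi Cg) (twist_map tw P) h = aord (curve_phi Cf) P (T h).
  suff -> : aord (curve_phi Cg) (twist_map tw P) = aord (curve_phi Cf) P \o T by [].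
  apply: (aord_unique Sg).
    apply: (@pullback_kvaluation _ _ _ _ (curve_phi Cf) T T_bij TC).
    by have [] := aord_spec Sf P.
  by have [vk vc] := aord_spec Sf P; exact: (twist_centered Sf TE b0 vk vc).
have mapK' : cancel (twist_map tw') (twist_map tw).
  move=> P; apply: val_inj => /=; case: (val P) => [[x y]|] //=.
  by rewrite subrK mulVKf.
have reg (P : point f d) (h : funfield g d) :
    regular (twist_map tw P) h <-> regular P ((T : {rmorphism funfield g d ->
      funfield f d}) h).
  rewrite /regular (ordE Cf) (ordE Cg) ordT.
  split=> -[h0|H]; [left | by right | left | by right].
    exact: (etrans (congr1 T h0) (rmorph0 T)).
  exact: (etrans (esym (TK h)) (etrans (congr1 T' h0) (rmorph0 T'))).
have rat (h : funfield g d) : rational_fun K0 h <->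
    rational_fun K0 ((T : {rmorphism funfield g d -> funfield f d}) h).
  split=> [H|]; first exact: (twist_rational TE aK bK H).
  move=> /(twist_rational T'E); rewrite rpredN rpredV => /(_ aK bK).
  by rewrite [T' _](TK h).
by exists (@CurveIso K K0 f g d (twist_map tw) (twist_map tw') (twist_mapK tw tw' b0)
  mapK' T T_bij TC reg rat).
Qed.

(** * The family f_{B,B1} *)

(** Serves to read one coefficient: q will be divisible by a power of X large enough for q^2 r not
    to contribute. *)
Lemma exprD_second_order (R : comNzRingType) (p q : R) d : (0 < d)%N ->
  exists r, (p + q) ^+ d = p ^+ d + p ^+ d.-1 * q *+ d + q ^+ 2 * r.
Proof.
case: d => // d _; rewrite exprDn big_ord_recl big_ord_recl /= bin0 bin1 subn0 subn1.
rewrite expr0 mulr1 expr1 mulr1n addrA.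
exists (\sum_(i < d) p ^+ (d.+1 - i.+2) * q ^+ i *+ 'C(d.+1, i.+2)).
congr (_ + _); rewrite mulr_sumr; apply: eq_bigr => i _.
rewrite /= /bump /= !add1n !exprS expr0 mulr1 mulrnAr; congr (_ *+ _).
move: (p ^+ _) (q ^+ i) => a b; ring.
Qed.

Section FamilyCoefficients.
Variables (K : closedFieldType) (n d : nat) (B B1 : K).
Local Notation l := (ell0 n d).
Hypotheses (d_gt1 : (1 < d)%N) (d_char : d%:R != 0 :> K) (l_ge2 : (2 <= l)%N).

Let m0_gt : (l < m0 n d)%N.
Proof. by rewrite /m0; move: l_ge2 d_gt1; nia. Qed.

(** The coefficient of x is d B1. That of x^l is d B plus a coefficient of (1 + B1 x)^d, already
    known to lie in K_0. The term in x^m0 does not interfere since m0 > l, and d is invertible. *)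
Lemma fBB_coefs (K0 : divringClosed K) :
  fBB n d B B1 \is a polyOver K0 -> B \in K0 /\ B1 \in K0.
Proof.
move=> /polyOverP hK.
have dK : d%:R \in K0 by rewrite rpred_nat.
have d_gt0 : (0 < d)%N by exact: ltnW.
have h1 : (fBB n d B B1)`_1 = B1 * d%:R.
  have [r E] := exprD_second_order 1 ('X * (B *: 'X^(l.-1) + B1%:P)) d_gt0.
  have -> : fBB n d B B1 = - (B ^+ d *: 'X^(m0 n d)) + (1 + 'X * (B *: 'X^(l.-1) +
    B1%:P)) ^+ d.
    rewrite /fBB; congr (_ + _ ^+ _).
    by rewrite mulrDr -scalerAr -exprS prednK 1?ltnW // -(mul_polyC B1) (mulrC 'X); ring.
  rewrite E !expr1n mul1r coefD coefN coefZ coefXn !coefD coef1 coefMn coefXM exprMn.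
  rewrite -mulrA coefXnM coefD coefZ coefXn coefC /=.
  have -> : (1 == m0 n d)%N = false by apply/eqP; move: m0_gt l_ge2; lia.
  have -> : (0 == l.-1)%N = false by apply/eqP; move: l_ge2; lia.
  by rewrite !mulr0 oppr0 !add0r addr0 mulr_natr.
have B1K : B1 \in K0.
  by rewrite -[B1](mulfK d_char) -h1 rpred_div.
split=> //.
pose p := 1 + B1 *: 'X : {poly K}.
have [r E] := exprD_second_order p (B *: 'X^l) d_gt0.
have hl : (fBB n d B B1)`_l = (p ^+ d)`_l + B * d%:R.
  have -> : fBB n d B B1 = - (B ^+ d *: 'X^(m0 n d)) + (p + B *: 'X^l) ^+ d.
    by rewrite /fBB /p; congr (_ + _ ^+ _); move: (B *: 'X^l) (B1 *: 'X) => u v; ring.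
  rewrite E !coefD coefN coefZ coefXn exprZn -exprM -scalerAl coefZ coefXnM.
  have -> : (l == m0 n d)%N = false by apply/eqP; move: m0_gt; lia.
  have -> : (l < l * 2)%N by move: l_ge2; lia.
  rewrite !mulr0 oppr0 add0r addr0 coefMn -scalerAr coefZ coefMXn ltnn subnn.
  rewrite -horner_coef0 horner_exp /p !hornerE expr1n mulr1 mulr_natr.
  by [].
have pK : p ^+ d \is a polyOver K0.
  by rewrite rpredX // rpredD ?rpred1 // polyOverZ // polyOverX.
have -> : B = ((fBB n d B B1)`_l - (p ^+ d)`_l) / d%:R by rewrite hl addrC addKr mulfK.
by rewrite rpred_div // rpredB // (polyOverP pK).
Qed.

End FamilyCoefficients.

Section Family.
Variables (K : closedFieldType) (n d : nat) (B B1 : K).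
Local Notation l := (ell0 n d).
Local Notation h := (fBB n d B B1).
Local Notation A := {poly {poly K}}.
Hypotheses (d_gt1 : (1 < d)%N) (d_char : d%:R != 0 :> K) (l_ge2 : (2 <= l)%N).
Hypothesis nE : (n + l = (d * l).+1)%N.
Hypotheses (B_neq0 : B != 0) (B1_neq0 : B1 != 0).

Let c : {poly K} := B *: 'X^l + (B1 *: 'X + 1).

Let hE : h = c ^+ d - (B *: 'X^l) ^+ d.
Proof. by rewrite /fBB /c addrC addrA exprZn -exprM mulnC. Qed.

Let c0 : c.[0] = 1.
Proof.
rewrite /c hornerD hornerZ hornerXn expr0n (gtn_eqF (ltnW l_ge2)) mulr0 add0r.
by rewrite hornerD hornerZ hornerX mulr0 add0r hornerC.
Qed.

Let size_c : size c = l.+1.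
Proof.
have sl : size (B1 *: 'X + 1) = 2%N.
  by rewrite size_polyDl size_scale // size_polyX // size_poly1.
by rewrite size_polyDl size_scale ?size_polyXn // sl ltnS.
Qed.

(** The factor B1 x + 1 of c^d - (B x^l)^d has degree 1 and its cofactor degree (d - 1) l = n -
    1. *)
Lemma size_fBB : size h = n.+1.
Proof.
have sl : size (B1 *: 'X + 1) = 2%N.
  by rewrite size_polyDl size_scale // size_polyX // size_poly1.
have sq : size (B *: 'X^l) = l.+1 by rewrite size_scale // size_polyXn.
have lc : lead_coef c = lead_coef (B *: 'X^l).
  by rewrite lead_coefDl // sq sl ltnS.
rewrite hE subrXX.
have -> : c - B *: 'X^l = B1 *: 'X + 1 by rewrite /c addrC addKr.
have sS := size_power_quotient d_char size_c sq lc.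
rewrite size_mul -?size_poly_gt0 ?sl ?sS //.
have : (d.-1 * l + l = d * l)%N by rewrite addnC -mulSn prednK // ltnW.
move: nE; move: (d.-1 * l)%N (d * l)%N; clear; lia.
Qed.

Lemma fBB_at q : h.[q] = c.[q] ^+ d - (B * q ^+ l) ^+ d.
Proof. by rewrite hE !hornerE. Qed.

(** At x = -1/B1 the linear part B1 x + 1 vanishes and the two d-th powers cancel. *)
Lemma fBB_onQ : 0 ^+ d == h.[- B1^-1].
Proof.
have cQ : c.[- B1^-1] = B * (- B1^-1) ^+ l.
  rewrite /c hornerD hornerZ hornerXn hornerD hornerZ hornerX hornerC.
  by rewrite mulrN mulfV // addNr addr0.
by rewrite fBB_at cQ subrr expr0n gtn_eqF // ltnW.
Qed.

Lemma fBB_curve : coprime n d -> no_repeated_roots h -> smooth_curve h d n.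
Proof. by move=> cop sqf; split=> //; exact: size_fBB. Qed.

Section Torsion.
Variables (L : fieldType) (phi : {rmorphism A -> L}).
Hypothesis S : smooth_model h d n phi.
Variable R : point h d.
Hypothesis RE : val R = Some (0, 1).

Lemma kills_fBB : kills phi R (d * l).
Proof.
have d_gt0 : (0 < d)%N := ltnW d_gt1.
have wlt_const k (e : K) : (0 < k)%N -> wlt d n k e%:P%:P.
  move=> k0 i j; rewrite coefC; case: ifP => [/eqP->|_]; last by rewrite coef0 eqxx.
  by rewrite coefC; case: ifP => [/eqP->|_]; rewrite ?eqxx // !muln0.
have dl_gt : (d < d * l)%N by move: d_gt1 l_ge2; nia.
(* The pole order d l comes from -B x^l, since y has weight n < d l. *)
apply: (killsI S RE (u := 'X - c%:P)).
- exists (- B), l, 0%N, ('X - (B1 *: 'X + 1)%:P).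
  split; rewrite ?oppr_eq0 ?muln0 ?addn0 //.
    apply: wltB.
      have -> : 'X = mono 1 0 1 :> A by rewrite /mono scale1r expr0 expr1 mul1r.
      by apply: wlt_mono; rewrite muln0 muln1; move: nE l_ge2; lia.
    rewrite polyCD; apply: wltD; last by apply: wlt_const; move: dl_gt; lia.
    have -> : (B1 *: 'X)%:P = mono B1 1 0 :> A by rewrite /mono expr0 expr1 mulr1.
    by apply: wlt_mono; rewrite muln0 muln1 addn0.
  congr (phi _); rewrite /mono expr0 mulr1 /c [in LHS]polyCD scaleNr polyCN.
  by rewrite opprD addrCA.
- move=> [x y] /= on; rewrite at_pointB at_pointX at_pointC /= => /eqP.
  rewrite subr_eq0 => /eqP yE; move: on; rewrite fBB_at -yE => /eqP.
  rewrite eq_sym -subr_eq0 addrC addKr oppr_eq0 expf_eq0 d_gt0 mulf_eq0 (negPf B_neq0).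
  rewrite /= expf_eq0 => /andP[_ /eqP x0]; rewrite x0 in yE *; congr (_, _).
  by rewrite yE c0.
have vR := aord_valuation S R.
(* On the curve (y - c) s = y^d - c^d = -(B x^l)^d. The cofactor s takes the value d at (0, 1), so
   it is a unit there, and x is a parameter there; this gives the order d l. *)
pose s : A := \sum_(i < d) 'X ^+ (d.-1 - i) * c%:P ^+ i.
have s1 : at_point (0, 1) s != 0.
  rewrite /s /at_point /= !horner_sum (eq_bigr (fun=> 1)); last first.
    move=> i _; rewrite hornerM !horner_exp hornerX hornerC hornerM !horner_exp
      hornerC c0.
    by rewrite !expr1n mulr1.
  by rewrite sumr_const card_ord.
have us : phi ('X - c%:P) * phi s = - (phi (B%:P%:P) * phi ('X - 0%:P)%:P ^+ l) ^+ d.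
  rewrite -rmorphM -subrXX rmorphB rmorphXn (phiXd S) -polyC_exp hE polyCB rmorphB.
  rewrite addrAC subrr add0r -mul_polyC polyC_exp rmorphXn polyCM rmorphM subr0.
  by rewrite polyC_exp [phi ('X%:P ^+ l)]rmorphXn.
have x0 : phi ('X - 0%:P)%:P != 0 by rewrite (phiC_eq0 S) polyXsubC_eq0.
have b0 : phi B%:P%:P != 0 by rewrite (phiC_eq0 S) polyC_eq0.
have s0 : phi s != 0.
  apply: contraNneq s1 => s0; apply/eqP.
  by rewrite (@at_point_eq _ _ _ _ _ _ S _ (on_affine RE) s 0) ?rmorph0 // at_pointC
    hornerC.
have u0 : phi ('X - c%:P) != 0.
  apply: contraTneq (expf_neq0 d (mulf_neq0 b0 (expf_neq0 l x0))) => u0.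
  by rewrite negbK -oppr_eq0 -us u0 mul0r.
have := congr1 (aord phi R) us;
  rewrite (valuationM vR) // (aord_unit S RE s1) addr0 => ->.
rewrite (valuationN vR) (valuationX vR) ?mulf_neq0 ?expf_neq0 //.
rewrite (valuationM vR) ?expf_neq0 // (valuationX vR) // (aord_x S RE) /ramification
  oner_eq0.
have [[_ vC _] _] := aord_spec S R.
by rewrite vC add0r mul1r mulrC PoszM.
Qed.

Lemma aorder_fBB : aorder phi R (d * l).
Proof.
apply: (aorder_nonbranch S RE) => /=; [exact: oner_neq0 | | exact: kills_fBB].
by move: nE l_ge2 d_gt1; nia.
Qed.

End Torsion.
End Family.

(** * Rationality over K_0 of affine functions and of inverse images *)

Lemma linear_factor_coefs (K : closedFieldType) (K0 : divringClosed K) (p q : {poly K})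
    (s t : K) : p \is a polyOver K0 -> q \is a polyOver K0 -> p != 0 ->
  (s *: 'X + t%:P) * p = q -> s \in K0 /\ t \in K0.
Proof.
move=> pK qK p0 E; have lp0 : lead_coef p != 0 by rewrite lead_coef_eq0.
have lpK : lead_coef p \in K0 by rewrite lead_coefE (polyOverP pK).
have sK : s \in K0.
  have : q`_(size p) = s * lead_coef p.
    rewrite -E mulrDl -scalerAl coefD coefZ coefXM coefCM [p`_(size p)]nth_default //.
    by rewrite mulr0 addr0 size_poly_eq0 (negPf p0) lead_coefE.
  by move=> qs; rewrite -[s](mulfK lp0) -qs rpred_div // (polyOverP qK).
split=> //; rewrite -[t](mulfK lp0) rpred_div //.
have -> : t * lead_coef p = (q - s *: 'X * p)`_(size p).-1.
  by rewrite -E mulrDl addrC addKr coefCM lead_coefE.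
apply: (polyOverP (S := K0)).
by rewrite rpredB // rpredM // polyOverZ // polyOverX.
Qed.

Section AffineFunctions.
Variables (K : closedFieldType) (g : {poly K}) (d n : nat) (L : fieldType).
Local Notation A := {poly {poly K}}.
Variable phi : {rmorphism A -> L}.
Hypothesis S : smooth_model g d n phi.
Let M := smooth_model_model S.

(** A pole of order d < n at O leaves no room for y, and weight d bounds the degree in x by 1. *)
Lemma affine_of_pole_order h : (d < n)%N -> h != 0 ->
    (forall P : point g d, P != infty -> vge (aord phi P) 0 h) ->
    aord phi (infty : point g d) h = - d%:Z ->
  exists s t, h = phi (s *: 'X + t%:P)%:P.
Proof.
move=> dn h0 reg hinf; have [u su hu] := poly_of_regular S reg.
rewrite {}hu in h0 hinf *; have [k uk] := wt_ex M h0.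
have kd : k = d by move: hinf; rewrite (aord_infty S uk) => /oppr_inj [].
rewrite kd in uk; have ku := reduced_wlt S su uk.
exists (u`_0)`_1, (u`_0)`_0; congr (phi _).
apply/polyP => j; apply/polyP => i; rewrite coefC; case: j => [|j] /=.
  rewrite coefD coefZ coefX coefC; case: i => [|[|i]] /=.
  - by rewrite mulr0 add0r.
  - by rewrite mulr1 addr0.
  rewrite mulr0 addr0; apply/eqP; apply: contraT => /ku; rewrite muln0 addn0 ltnS.
  by rewrite -{2}[d]muln1 leq_mul2l gtn_eqF // (model_d_gt0 M).
rewrite coef0; apply/eqP; apply: contraT => /ku; rewrite mulnS => H; exfalso.
by move: H dn; move: (d * i)%N (n * j)%N; clear; lia.
Qed.

(** Reduction modulo y^d = f keeps coefficients in K_0 and turns the relation into an identity of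
    polynomials. Comparing leading coefficients in y exhibits s x + t as a quotient of polynomials
    in x over K_0. *)
Lemma affine_rational (K0 : divringClosed K) s t u w :
    g \is a polyOver K0 -> coefs_in K0 u -> coefs_in K0 w -> phi w != 0 ->
    phi (s *: 'X + t%:P)%:P * phi w = phi u ->
  s \in K0 /\ t \in K0.
Proof.
move=> gK uK wK w0 E.
have [k1 ku] := wlt_ex d n u; have [r1 [sr1 _ r1E r1K]] := wlt_reduce M ku.
have [k2 kw] := wlt_ex d n w; have [r2 [sr2 _ r2E r2K]] := wlt_reduce M kw.
have {}r1K := r1K K0 gK uK; have {}r2K := r2K K0 gK wK.
have rr : (s *: 'X + t%:P)%:P * r2 = r1.
  apply/eqP; rewrite -subr_eq0; apply/eqP/(model_inj M).
    rewrite (leq_trans (size_polyD _ _)) // size_polyN geq_max sr1 andbT.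
    by rewrite mul_polyC (leq_trans (size_scale_leq _ _)).
  by rewrite rmorphB rmorphM r1E r2E E subrr.
have r20 : r2 != 0 by apply: contraNneq w0 => r20; rewrite -r2E r20 rmorph0.
have lr20 : lead_coef r2 != 0 by rewrite lead_coef_eq0.
apply: (@linear_factor_coefs _ _ (lead_coef r2) (r1`_(size r2).-1)) => //.
- by apply/polyOverP => i; exact: r2K.
- by apply/polyOverP => i; exact: r1K.
by rewrite -rr coefCM lead_coefE.
Qed.

Lemma aord_x_ge0 (P : point g d) : P != infty -> 0 <= aord phi P (phi 'X%:P).
Proof.
move=> Pi; case E : (val P) => [q|]; last by case/eqP: Pi; exact: val_inj.
by have := aord_ge0 S E 'X%:P; rewrite vgeE // (phiC_eq0 S) polyX_eq0.
Qed.

Lemma aord_x_infty : aord phi (infty : point g d) (phi 'X%:P) = - d%:Z.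
Proof.
apply: (aord_infty S); have := mono_wt d n phi 1 0 (oner_neq0 K).
by rewrite muln1 muln0 addn0 /mono scale1r expr0 expr1 mulr1.
Qed.

End AffineFunctions.

Section IsoRational.
Variables (K : closedFieldType) (K0 : divringClosed K) (f g : {poly K}) (d n : nat).
Hypotheses (Cf : smooth_curve f d n) (Cg : smooth_curve g d n).
Hypotheses (d_lt_n : (d < n)%N) (gK : g \is a polyOver K0).
Variable Psi : curve_iso K0 f g d.
Hypothesis Psi_infty : Psi infty = infty.
Local Notation A := {poly {poly K}}.
Local Notation phif := (curve_phi Cf).
Local Notation phig := (curve_phi Cg).
Local Notation T := (field_pullback Cf Cg (iso_pb Psi)).
Let Sf := smooth_model_phi Cf.
Let Sg := smooth_model_phi Cg.

(* The coordinate x of the source is an affine function over K_0 of the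
   coordinate x of the target, because it has a single pole, of order d < n. *)
Lemma pullback_x : exists s t, [/\ s \in K0, t \in K0 &
  T (phig (s *: 'X + t%:P)%:P) = phif 'X%:P].
Proof.
have [T' TK T'K] := iso_pb_bij Psi.
pose h : curve_field Cg := T' (phif 'X%:P).
have hT : T h = phif 'X%:P by exact: T'K.
have ordh Q : aord phig Q h = aord phif (iso_inv Psi Q) (phif 'X%:P).
  by rewrite -hT -iso_ord iso_invK.
have h0 : h != 0.
  by rewrite -(fmorph_eq0 T) hT (phiC_eq0 Sf) polyX_eq0.
have inv_infty : iso_inv Psi infty = infty by rewrite -Psi_infty iso_mapK.
have [||s [t hE]] := affine_of_pole_order Sg d_lt_n h0.
- move=> Q Qi; rewrite vgeE // ordh; apply: (aord_x_ge0 Sf).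
  by apply: contraNneq Qi => QE; rewrite -(iso_invK Psi Q) QE Psi_infty.
- by rewrite ordh inv_infty (aord_x_infty Sf).
have rX : rational_fun K0 (funX f d).
  apply/rational_fun_coefs; exists 'X%:P, 1; split.
  - by apply: coefs_inC; exact: polyOverX.
  - by have := coefs_inXn K0 0; rewrite expr0.
  - by rewrite funxy1 unitr1.
  by rewrite funxy1 divr1.
have : @rational_fun K g d K0 h.
  by apply/(iso_pb_rational Psi); have -> : iso_pb Psi h = funX f d by exact: hT.
move=> /rational_fun_coefs[u [w [uK wK wU hE']]].
have w0 : phig w != 0 by exact: (etrans (esym (funfield_unit Cg _)) wU).
have hE2 : h = phig u / phig w := hE'.
have E : phig (s *: 'X + t%:P)%:P * phig w = phig u.
  by rewrite -hE hE2 divfK.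
have [sK tK] := affine_rational Sg gK uK wK w0 E.
exists s, t; split; [exact: sK | exact: tK |].
exact: (etrans (congr1 T (esym hE)) hT).
Qed.

(** The inverse image has order d < n, so its ordinate is 0 by [kills_small]. If x' is its abscissa,
    x - x' vanishes there and is the pullback of s x + t - x' with s, t in K_0; evaluation at Q
    expresses x' in K_0. *)
Lemma iso_inv_branch (Q : point g d) x : val Q = Some (x, 0) -> x \in K0 ->
  rational_point K0 (iso_inv Psi Q) /\ point_order (iso_inv Psi Q) d.
Proof.
move=> QE xK; have ordQ := aorder_branch Sg QE d_lt_n erefl.
have ordR : point_order (iso_inv Psi Q) d.
  apply/(point_order_iso Cf Cg _ _ Psi_infty); rewrite iso_invK.
  exact/(point_orderE Cg).
split=> //; rewrite /rational_point.
case RE : (val (iso_inv Psi Q)) => [[x' y']|//].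
have [d0 Rd _] := (point_orderE Cf _ _).1 ordR.
have d0n : (0 < d < n)%N by rewrite d0.
have [/= y'0 _] := kills_small Sf RE d0n Rd.
split; last by rewrite y'0 rpred0.
have [s [t [sK tK TE]]] := pullback_x.
have TEx : T (phig (s *: 'X + t%:P - x'%:P)%:P) = phif ('X - x'%:P)%:P.
  rewrite polyCB rmorphB rmorphB TE [in RHS]polyCB [RHS]rmorphB; congr (_ - _).
  exact: (iso_pbC Psi).
have : 0 < aord phig Q (phig (s *: 'X + t%:P - x'%:P)%:P).
  rewrite -(iso_invK Psi Q) iso_ord TEx (aord_x Sf RE) /ramification.
  by case: ifP => _; rewrite ?ltz_nat.
move=> /(aord_gt0_at Sg QE); rewrite at_pointC !hornerE /= => /eqP.
by rewrite subr_eq0 => /eqP<-; rewrite rpredD ?rpredM.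
Qed.

End IsoRational.

(** * Numerical bounds, coordinates for the normal form, and the equivalence *)

(** From d l <= n + d and n = d l + 1 - l follows l <= d + 1; the case l = d + 1 gives n = d^2,
    which is not prime to d. *)
Lemma ell0_bounds (n d : nat) :
    (2 <= d)%N -> (d < n)%N -> coprime n d ->
    n%:Z - (m0 n d)%:Z + (ell0 n d)%:Z = 1 ->
  [/\ (2 <= ell0 n d)%N, (ell0 n d <= d)%N & (n + ell0 n d = (d * ell0 n d).+1)%N].
Proof.
move=> d2 dn cop; rewrite /m0 => E.
have nE : (n + ell0 n d = (d * ell0 n d).+1)%N by lia.
have l2 : (2 <= ell0 n d)%N by rewrite leq_divRL ?(ltnW d2) //; lia.
have ln : (d * ell0 n d <= n + d)%N by rewrite mulnC leq_trunc_div.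
split=> //; rewrite leqNgt; apply/negP => dl.
have lE : ell0 n d = d.+1 by lia.
have nd : n = (d * d)%N by move: nE; rewrite lE mulnS; lia.
by move: cop; rewrite nd /coprime gcdnC gcdnMl; lia.
Qed.

Lemma comp_poly_exp (R : comNzRingType) (p q : {poly R}) k :
  (p ^+ k) \Po q = (p \Po q) ^+ k.
Proof. exact: rmorphXn. Qed.

(** Moving a to 0 and dividing y by b makes the constant term 1, which divides both other constants
    by b. *)
Lemma fBB_twist (K : closedFieldType) (n d : nat) (a b B B1 : K) (f : {poly K}) :
    b != 0 ->
    f = (B *: ('X - a%:P) ^+ ell0 n d + B1 *: ('X - a%:P) + b%:P) ^+ d
        - (B *: ('X - a%:P) ^+ ell0 n d) ^+ d ->
  twist d (- a) b^-1 (fBB n d (B / b) (B1 / b)) f.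
Proof.
move=> b0 ->; rewrite /twist /fBB /m0 comp_polyD raddfN /= comp_poly_exp !comp_polyD.
rewrite !comp_polyZ !comp_poly_exp comp_polyX comp_polyC polyCN.
move: ('X - a%:P) => y; rewrite scalerBr -!exprZn.
rewrite !scalerDr !scalerA ![b^-1 * _]mulrC addrC; congr ((_ + _) ^+ _ - _).
  by rewrite -mul_polyC -polyCM mulVf.
by rewrite [RHS]exprZn -exprM mulnC.
Qed.

Lemma sqfree_twist (K : closedFieldType) (d : nat) (a b : K) (f g : {poly K}) :
  b != 0 -> twist d a b g f -> no_repeated_roots f -> no_repeated_roots g.
Proof.
move=> b0 tw sqf r; apply: contraNN (sqf (r - a)) => /(dvdp_comp_poly ('X + a%:P)).
rewrite tw dvdpZr ?expf_neq0 //; congr (_ %| _).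
rewrite comp_poly_exp comp_polyB comp_polyX comp_polyC polyCB; congr (_ ^+ _); ring.
Qed.

Theorem theorem4 (K : closedFieldType) (n d : nat)
  (hd : (2 <= d)%N) (hdn : (d < n)%N) (hnd : coprime n d)
  (hchar : d%:R != 0 :> K)
  (hnm : n%:Z - (m0 n d)%:Z + (ell0 n d)%:Z = 1)
  (K0 : divringClosed K) (hK0 : perfect_subfield K0)
  (hell : (ell0 n d)%:R != 0 :> K)
  (f : {poly K}) (hfK0 : f \is a polyOver K0) (hfn : size f = n.+1)
  (hf : no_repeated_roots f)
  (P : point f d) (hP : rational_point K0 P) :
  (point_order P (m0 n d) <->
     exists (B B1 : K) (Psi : curve_iso K0 f (fBB n d B B1) d),
       normal_form P Psi)
  /\
  (forall (B B1 : K) (Psi : curve_iso K0 f (fBB n d B B1) d),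
     normal_form P Psi ->
     (exists R : point (fBB n d B B1) d,
        [/\ val R = Some (0, 1), rational_point K0 R & point_order R (m0 n d)])
     /\
     (exists Q : point (fBB n d B B1) d,
        [/\ val Q = Some (- B1^-1, 0), rational_point K0 Q, point_order Q d,
            rational_point K0 (iso_inv Psi Q) & point_order (iso_inv Psi Q) d])).
Proof.
have [l2 ld nE] := ell0_bounds hd hdn hnd hnm.
have Cf : smooth_curve f d n by split.
have Sf := smooth_model_phi Cf.
have order_of_normal_form B B1 (Psi : curve_iso K0 f (fBB n d B B1) d) :
    normal_form P Psi -> point_order (Psi P) (m0 n d).
  move=> [[_ B0] [_ B10] sqf _ PsiP].
  have Ch := fBB_curve hd hchar l2 nE B0 B10 hnd sqf.
  apply/(point_orderE Ch); rewrite /m0.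
  exact: (aorder_fBB hd hchar l2 nE B0 B10 (smooth_model_phi Ch) PsiP).
split; first split.
- move=> /(point_orderE Cf) ordP.
  case PE : (val P) => [p|]; last first.
    (* O has order 1, whereas m0 > 1. *)
    have Pi : P = infty by apply: val_inj.
    case: ordP => _ _ /(_ 1%N); case; first by rewrite /m0 /=; move: l2 hd; nia.
    exists 1; first exact: oner_neq0.
    by move=> Q; rewrite (valuation1 (aord_valuation Sf Q)) Pi subrr.
  have [b0 [B' [B1' [B'0 B1'0 fE]]]] := normal_form_of_order Sf l2 ld nE PE ordP.
  have [aK bK] : p.1 \in K0 /\ p.2 \in K0.
    by move: hP; rewrite /rational_point PE; case: (p).
  pose a := p.1; pose b := p.2; pose B := B' / b; pose B1 := B1' / b.
  have B0 : B != 0 by rewrite mulf_neq0 ?invr_neq0.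
  have B10 : B1 != 0 by rewrite mulf_neq0 ?invr_neq0.
  have b'0 : b^-1 != 0 by rewrite invr_eq0.
  have tw : twist d (- a) b^-1 (fBB n d B B1) f.
    exact: fBB_twist.
  (* The polynomial is obtained from f by a change of coordinates whose constants a and b lie in
     K_0. *)
  have hK : fBB n d B B1 \is a polyOver K0.
    have := twist_inv b'0 tw; rewrite /twist opprK invrK => fcE.
    have -> : fBB n d B B1 = b^-1 ^+ d *: (f \Po ('X + a%:P)).
      by rewrite fcE scalerA exprVn mulVf ?expf_neq0 // scale1r.
    rewrite polyOverZ ?rpredX ?rpredV // polyOver_comp //.
    by rewrite polyOverXaddC.
  have [BK B1K] := fBB_coefs hd hchar l2 hK.
  have sqf := sqfree_twist b'0 tw hf.
  have Ch := fBB_curve hd hchar l2 nE B0 B10 hnd sqf.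
  have NaK : - a \in K0 by rewrite rpredN.
  have VbK : b^-1 \in K0 by rewrite rpredV.
  have [Psi PsiE] := twist_iso Cf Ch NaK VbK b'0 tw.
  exists B, B1, Psi; split=> //; first by apply: val_inj; rewrite PsiE.
  by rewrite PsiE PE /= subrr mulVf.
- move=> [B [B1 [Psi nf]]]; have [[_ B0] [_ B10] sqf Pi PsiP] := nf.
  have Ch := fBB_curve hd hchar l2 nE B0 B10 hnd sqf.
  by apply/(point_order_iso Cf Ch _ _ Pi); exact: order_of_normal_form.
move=> B B1 Psi nf; have [[BK B0] [B1K B10] sqf Pi PsiP] := nf.
have Ch := fBB_curve hd hchar l2 nE B0 B10 hnd sqf.
split.
  exists (Psi P); split=> //; last exact: order_of_normal_form.
  by rewrite /rational_point PsiP rpred0 rpred1.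
pose Q := apoint (fBB_onQ n B hd B10).
have QE : val Q = Some (- B1^-1, 0) by [].
have B1VK : - B1^-1 \in K0 by rewrite rpredN rpredV.
have hK : fBB n d B B1 \is a polyOver K0.
  rewrite /fBB rpredD ?rpredN ?polyOverZ ?rpredX ?rpredD ?polyOverZ ?polyOverX //.
    exact: polyOverXn.
  exact: rpred1.
have [Qr Qo] := iso_inv_branch Cf Ch hdn hK Pi QE B1VK.
exists Q; split; [exact: QE | | | exact: Qr | exact: Qo].
  by split=> //; rewrite rpred0.
by apply/(point_orderE Ch); exact: (aorder_branch (smooth_model_phi Ch) QE hdn erefl).
Qed.
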